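(* Let $k\ge 2$ be an integer and let $d=3k+2$. For both the inverse Gaussian distribution and the gamma distribution, with $d$th moment variety $\mathcal{M}_d\subseteq\mathbb{P}^d$, we have rational identifiability of $k$-mixtures from the first $3k+2$ moments up to permuting the mixture components: for a generic point $q\in\mathrm{Sec}_k(\mathcal{M}_d)$, the fiber $\Phi_{k,d}^{-1}(q)$ of the mixture moment map $\Phi_{k,d}$ (defined in the context) consists of exactly one orbit of the symmetric group $S_k$ acting by simultaneously permuting $(\theta^{(1)},\ldots,\theta^{(k)})$ and $(\alpha_1,\ldots,\alpha_k)$.
   Context: All varieties are over $\mathbb{C}$; ''generic'' means: for all points in some nonempty Zariski open subset. Moments. Inverse Gaussian distribution, with parameters $(\mu,\lambda)$, $\lambda\neq 0$: $m_0=1$, $m_1=\mu$, and $m_i=\frac{2i-3}{\lambda}\mu^2 m_{i-1}+\mu^2 m_{i-2}$ for $i\ge 2$. Gamma distribution, with parameters $(\kappa,\theta)$ (shape $\kappa$, scale $\theta$): $m_r=\theta^r\prod_{i=0}^{r-1}(i+\kappa)$ for $r\ge 0$ (so $m_0=1$). Moment variety. The $d$th moment variety $\mathcal{M}_d\subseteq\mathbb{P}^d$ of the distribution is the Zariski closure of the image of the rational map $\mathbb{C}^2\dashrightarrow\mathbb{P}^d$ sending the parameter pair to $[m_0:m_1:\cdots:m_d]$. Secant variety. For $X\subseteq\mathbb{P}^d$ irreducible, $\mathrm{Sec}_k(X)$ is the Zariski closure of the union of the linear spans of all $k$-tuples of points of $X$. Mixtures. The moment map of the $k$-mixture is the rational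 map $$\Phi_{k,d}\colon(\mathbb{C}^2)^k\times\{\alpha\in\mathbb{C}^k:\textstyle\sum_{i}\alpha_i=1\}\dashrightarrow\mathbb{P}^d,\quad (\theta^{(1)},\ldots,\theta^{(k)},\alpha)\mapsto\Big[\textstyle\sum_{i=1}^k\alpha_i m_r(\theta^{(i)})\Big]_{r=0,\ldots,d},$$ where $\theta^{(i)}\in\mathbb{C}^2$ denotes the parameter pair of the $i$th component, and its domain consists of the points where all moments are defined. The Zariski closure of its image is $\mathrm{Sec}_k(\mathcal{M}_d)$. *)

(* Defs.v *)
From HB Require Import structures.
From mathcomp Require Import all_boot all_order all_algebra all_fingroup.
From mathcomp Require Import boolp classical_sets reals complex mpoly.

Set Implicit Arguments.
Unset Strict Implicit.
Unset Printing Implicit Defensive.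

Import GRing.Theory.

Local Open Scope ring_scope.
Local Open Scope classical_set_scope.

(* The point [v_0 : ... : v_n] of P^n is the line <[v]>. *)
Definition proj_space (K : fieldType) (n : nat) : Type :=
  {L : {vspace 'rV[K]_n.+1} | \dim L == 1%N}.

Definition has_coords (K : fieldType) (n : nat) (q : proj_space K n)
    (v : 'rV[K]_n.+1) : Prop :=
  val q = <[v]>%VS.

Definition vanishes_at (K : fieldType) (n : nat) (f : {mpoly K[n.+1]})
    (q : proj_space K n) : Prop :=
  forall v : 'rV[K]_n.+1, v \in val q -> f.@[fun i => v ord0 i] = 0.

Definition zariski_closed (K : fieldType) (n : nat)
    (Z : set (proj_space K n)) : Prop :=
  exists F : set {mpoly K[n.+1]},
    (forall f, F f -> exists e : nat, f \is e.-homog) /\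
    Z = [set q | forall f, F f -> vanishes_at f q].

Definition zariski_closure (K : fieldType) (n : nat)
    (S : set (proj_space K n)) : set (proj_space K n) :=
  \bigcap_(Z in [set Z | zariski_closed Z /\ S `<=` Z]) Z.

(* [P] holds on a nonempty subset of [X] that is open in the subspace
   topology. *)
Definition for_generic (K : fieldType) (n : nat)
    (X P : set (proj_space K n)) : Prop :=
  exists Z : set (proj_space K n),
    [/\ zariski_closed Z, X `\` Z !=set0 & X `\` Z `<=` P].

Definition secant_variety (K : fieldType) (n k : nat)
    (X : set (proj_space K n)) : set (proj_space K n) :=
  zariski_closure
    [set q | exists p : 'I_k -> proj_space K n,
       (forall i, X (p i)) /\ (val q <= \sum_(i < k) val (p i))%VS].

Fixpoint inverse_gaussian_moment (K : fieldType) (mu lambda : K) (i : nat)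
    {struct i} : K :=
  if i is i1.+1 then
    if i1 is i2.+1 then
      ((2 * i)%N%:R - 3%:R) / lambda * mu ^+ 2
        * inverse_gaussian_moment mu lambda i1
      + mu ^+ 2 * inverse_gaussian_moment mu lambda i2
    else mu
  else 1.

Definition gamma_moment (K : fieldType) (kappa theta : K) (r : nat) : K :=
  theta ^+ r * \prod_(0 <= i < r) (i%:R + kappa).

Inductive distribution := InverseGaussian | Gamma.

(* Parameter pairs are (mu, lambda), resp. (kappa, theta). *)
Definition moment (K : fieldType) (D : distribution) (t : K * K) (r : nat) : K :=
  match D with
  | InverseGaussian => inverse_gaussian_moment t.1 t.2 r
  | Gamma => gamma_moment t.1 t.2 r
  end.

Definition moments_defined (K : fieldType) (D : distribution) (t : K * K) : Prop :=
  match D with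
  | InverseGaussian => t.2 <> 0
  | Gamma => True
  end.

Definition moment_variety (K : fieldType) (D : distribution) (d : nat) :
    set (proj_space K d) :=
  zariski_closure
    [set q | exists2 t : K * K, moments_defined D t &
       has_coords q (\row_(r < d.+1) moment D t r)].
Arguments moment_variety : clear implicits.

Definition mixture_param (K : fieldType) (k : nat) : Type :=
  ({ffun 'I_k -> K * K} * {ffun 'I_k -> K})%type.

Definition mixture_domain (K : fieldType) (D : distribution) (k : nat) :
    set (mixture_param K k) :=
  [set p : mixture_param K k | (forall i, moments_defined D (p.1 i)) /\ \sum_(i < k) p.2 i = 1].

Definition mixture_moments (K : fieldType) (D : distribution) (k d : nat)
    (p : mixture_param K k) : 'rV[K]_d.+1 :=
  \row_(r < d.+1) \sum_(i < k) p.2 i * moment D (p.1 i) r.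

Definition mixture_fiber (K : fieldType) (D : distribution) (k d : nat)
    (q : proj_space K d) : set (mixture_param K k) :=
  [set p : mixture_param K k | mixture_domain D p /\ has_coords q (mixture_moments D d p)].

Definition permute_mixture (K : fieldType) (k : nat) (s : 'S_k)
    (p : mixture_param K k) : mixture_param K k :=
  ([ffun i => p.1 (s i)], [ffun i => p.2 (s i)]).

Definition mixture_orbit (K : fieldType) (k : nat) (p : mixture_param K k) :
    set (mixture_param K k) :=
  [set permute_mixture s p | s in [set: 'S_k]].

(* Main.v *)
Require Import Defs.
From mathcomp Require Import all_boot all_order all_algebra all_fingroup.
From mathcomp Require Import boolp classical_sets reals complex mpoly.
From mathcomp Require Import closed_field ring lra zify.

(* In coordinates (mu, nu), with nu = mu^2 / lambda resp. theta, the r-th moment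
   is a polynomial v_r(mu, nu), and a mixture is q = sum_i a_i v(x_i).

   Choose the 3k coordinates of the x_i and a_i to have dual derivations of C,
   i.e. derivations D_i of the field C with D_i(p_j) = delta_ij; these exist
   because C is uncountable and derivations extend to overfields in
   characteristic 0. Suppose sum_i a_i v(x_i) = sum_j b_j v(y_j). Applying the
   D_i shows that the span W of the tangent spaces at the x_i is contained in
   that of the tangent spaces at the y_j, hence equal to it. In particular
   v(y_j) = sum_i (A_i v + B_i v_mu + C_i v_nu)(x_i). Differentiating this along
   nu_i puts B_i v_munu(x_i) + C_i v_nunu(x_i) in W, so B = C = 0, because along
   nu = 0 the relevant vectors span osculating spaces of the rational normal
   curve and are independent by Hermite interpolation. Differentiating once more
   shows that a single A_i is nonzero, whence y_j = x_i.

   Finally, "the fibre is one orbit" is a first-order condition, so by quantifier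
   elimination its truth at a point of the secant variety depends only on the
   vanishing of finitely many polynomials; it therefore holds on a nonempty open
   subset as soon as it holds at one sufficiently generic point. *)

Set Implicit Arguments.
Unset Strict Implicit.
Unset Printing Implicit Defensive.

Import Order.TTheory GRing.Theory Num.Theory.

Local Open Scope ring_scope.
Local Open Scope classical_set_scope.

(** * Extension of derivations *)

Section DerivationExtension.
Variable K : numFieldType.

Definition derivation (D : K -> K) : Prop :=
  (forall x y, D (x + y) = D x + D y) /\
  (forall x y, D (x * y) = D x * y + x * D y).

(* [(x, x')] stands for the dual number [x + e x'], so these are the subrings of
   [K[e]] that are graphs of derivations. *)
Definition derivation_graph (G : set (K * K)) : Prop :=
  [/\ G (1, 0),
      forall u v, G u -> G v -> G (u.1 - v.1, u.2 - v.2),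
      forall u v, G u -> G v -> G (u.1 * v.1, u.2 * v.1 + u.1 * v.2)
    & forall b, G (0, b) -> b = 0].

Section Adjoin.
Variables (G : set (K * K)) (a b : K).
Hypothesis grG : derivation_graph G.

Let G1 : G (1, 0). Proof. by case: grG. Qed.
Let GB x y z t : G (x, y) -> G (z, t) -> G (x - z, y - t).
Proof. by case: grG => _ h _ _ u v; apply: h u v. Qed.
Let GM x y z t : G (x, y) -> G (z, t) -> G (x * z, y * z + x * t).
Proof. by case: grG => _ _ h _ u v; apply: h u v. Qed.
Let Gf c : G (0, c) -> c = 0. Proof. by case: grG => _ _ _; apply. Qed.
Let G0 : G (0, 0).
Proof. by have := GB G1 G1; rewrite !subrr. Qed.
Let GD x y z t : G (x, y) -> G (z, t) -> G (x + z, y + t).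
Proof.
move=> h1 h2; have := GB h1 (GB G0 h2).
by rewrite !sub0r !opprK.
Qed.
Let Gsum (I : Type) (r : seq I) (P : pred I) (f g : I -> K) :
  (forall i, G (f i, g i)) ->
  G (\sum_(i <- r | P i) f i, \sum_(i <- r | P i) g i).
Proof.
move=> h; elim: r => [|i r IH]; first by rewrite !big_nil.
by rewrite !big_cons; case: ifP => // _; apply: GD.
Qed.

(** The pair [(f, g)] stands for the polynomial [f + e g] over the dual numbers. *)
Definition poly_graph (f g : {poly K}) := forall i, G (f`_i, g`_i).

Let PB f f' g g' : poly_graph f f' -> poly_graph g g' -> poly_graph (f - g) (f' - g').
Proof. by move=> h1 h2 i; rewrite !coefB; apply: GB. Qed.

Let PM f f' g g' : poly_graph f f' -> poly_graph g g' ->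
  poly_graph (f * g) (f' * g + f * g').
Proof.
move=> h1 h2 i; rewrite coefD !coefM -big_split /=.
by apply: Gsum => j; apply: GM.
Qed.

Let PC x y : G (x, y) -> poly_graph x%:P y%:P.
Proof. by move=> h i; rewrite !coefC; case: ifP. Qed.

Let PX : poly_graph 'X 0.
Proof. by move=> i; rewrite coefX coef0; case: (_ == _). Qed.

Let PXn n : poly_graph 'X^n 0.
Proof. by move=> i; rewrite coefXn coef0; case: (_ == _). Qed.

(** These are the values [(f + e g)(a + e b)], that is, the subring of the dual numbers generated by
    [G] and [a + e b]. *)
Definition adjoin_graph : set (K * K) :=
  [set u | exists f g, poly_graph f g /\ u = (f.[a], f^`().[a] * b + g.[a])].

Lemma adjoin_graph_sup : G `<=` adjoin_graph.
Proof.
move=> [x y] h; exists x%:P, y%:P; split; first exact: PC.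
by rewrite derivC !hornerC mul0r add0r.
Qed.

Lemma adjoin_graph_gen : adjoin_graph (a, b).
Proof.
exists 'X, 0; split; first exact: PX.
by rewrite derivX hornerX hornerC mul1r horner0 addr0.
Qed.

Lemma adjoin_graph_derivation :
  (forall f g, poly_graph f g -> f.[a] = 0 -> f^`().[a] * b + g.[a] = 0) ->
  derivation_graph adjoin_graph.
Proof.
move=> H; split.
- exact/adjoin_graph_sup/G1.
- move=> _ _ [f [f' [hf ->]]] [g [g' [hg ->]]] /=.
  exists (f - g), (f' - g'); split; first exact: PB.
  by rewrite derivB !hornerD !hornerN mulrDl mulNr opprD addrACA.
- move=> _ _ [f [f' [hf ->]]] [g [g' [hg ->]]] /=.
  exists (f * g), (f' * g + f * g'); split; first exact: PM.
  rewrite derivM !hornerD !hornerM; congr (_, _).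
  rewrite !mulrDl !mulrDr !addrA; congr (_ + _).
  rewrite (mulrAC _ g.[a]) !mulrA.
  by rewrite -!addrA; congr (_ + _); rewrite addrC.
- by move=> c [f [g [h [e1 ->]]]]; apply: H.
Qed.

Let PMn f f' n : poly_graph f f' -> poly_graph (f *+ n) (f' *+ n).
Proof.
move=> h i; rewrite !coefMn; elim: n => [|n IH]; first by rewrite !mulr0n.
by rewrite !mulrS; apply: GD.
Qed.

Let Pderiv f f' : poly_graph f f' -> poly_graph f^`() f'^`().
Proof. by move=> h i; rewrite !coef_deriv; have := @PMn f f' i.+1 h i.+1; rewrite !coefMn. Qed.

(* [m] is a relation of minimal degree for [a], so its formal derivative does not
   vanish at [a]; this forces the value [b] of the derivation at [a]. *)
Lemma adjoin_graph_minimal (m m' : {poly K}) :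
  poly_graph m m' -> m != 0 -> m.[a] = 0 ->
  (forall f g, poly_graph f g -> f != 0 -> f.[a] = 0 -> (size m <= size f)%N) ->
  m^`().[a] != 0 /\ (b = - m'.[a] / m^`().[a] ->
  forall f g, poly_graph f g -> f.[a] = 0 -> f^`().[a] * b + g.[a] = 0).
Proof.
move=> hm m0 ma mmin.
have dm0 : m^`() != 0.
  apply: contra_neq m0 => dm0.
  have /size1_polyC mC : (size m <= 1)%N.
    apply/leq_sizeP => -[//|i] _; have /polyP/(_ i)/eqP := dm0.
    by rewrite coef_deriv coef0 mulrn_eq0 => /eqP.
  by move: ma; rewrite mC hornerC => ->.
have dma : m^`().[a] != 0.
  apply/negP => /eqP dma; have := mmin _ _ (Pderiv hm) dm0 dma.
  by apply/negP; rewrite -ltnNge lt_size_deriv.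
split=> // eb f; have [n] := ubnP (size f); elim: n f => // n IH f.
rewrite ltnS => sf g hg fa.
have dam : m^`().[a] * b + m'.[a] = 0.
  by rewrite eb mulrC divfK // addNr.
have [f0|f0] := eqVneq f 0.
  have g0 : g = 0.
    by apply/polyP => i; rewrite coef0; apply: Gf; have := hg i; rewrite f0 coef0.
  by rewrite f0 g0 deriv0 !horner0 mul0r addr0.
have le_mf := mmin _ _ hg f0 fa.
(* One step of pseudo-division of [f] by [m]: [G] need not be closed under inverses, so [f] is first
   multiplied by the leading coefficient of [m], and then the leading terms are cancelled. *)
pose c := lead_coef m; pose c1 := m'`_(size m).-1.
pose l := lead_coef f; pose l1 := g`_(size f).-1.
have hc : G (c, c1) by apply: hm.
have hl : G (l, l1) by apply: hg.
pose e := (size f - size m)%N.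
have hq := PM (PC hl) (PXn e).
have hr := PB (PM (PC hc) hg) (PM hq hm).
set r := (c%:P * f - _) in hr; set r1 := (X in poly_graph r X) in hr.
have c0 : c != 0 by rewrite lead_coef_eq0.
have sr : (size r < n)%N.
  have sz1 : (size (c%:P * f)%R <= size f)%N by rewrite mul_polyC size_scale.
  have sz2 : (size (l%:P * 'X^e * m)%R <= size f)%N.
    rewrite -mulrA mul_polyC (leq_trans (size_scale_leq _ _)) //.
    by rewrite mulrC size_mulXn // /e subnK.
  have szr : (size r <= size f)%N.
    by apply: leq_trans (size_polyD _ _) _; rewrite size_polyN geq_max sz1 sz2.
  have fpos : (0 < size f)%N by rewrite size_poly_gt0.
  apply: leq_trans sf.
  rewrite -(ltn_predK fpos) ltnS; apply/leq_sizeP => j le_j.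
  have [lt_j|] := ltnP j (size f); last by move=> le; apply: nth_default (leq_trans szr le).
  have -> : j = (size f).-1 by apply/eqP; rewrite eqn_leq le_j andbT -ltnS (ltn_predK fpos).
  rewrite /r coefB -mulrA !mul_polyC !coefZ coefXnM.
  have mpos : (0 < size m)%N by rewrite size_poly_gt0.
  have -> : ((size f).-1 < e)%N = false.
    by apply/negbTE; rewrite -leqNgt /e -(ltn_predK mpos) subnS -!subn1 leq_sub2r // leq_subr.
  have -> : ((size f).-1 - e = (size m).-1)%N.
    rewrite /e -(ltn_predK fpos) /= -(ltn_predK mpos) subSS.
    by rewrite subKn // -ltnS (ltn_predK fpos) (ltn_predK mpos).
  by rewrite -!lead_coefE mulrC subrr.
have ra : r.[a] = 0 by rewrite /r hornerD hornerN !hornerM ma fa !mulr0 subrr.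
have := IH _ sr _ hr ra.
rewrite /r /r1 !(derivB, derivD, derivM) !derivC !(hornerN, hornerD, hornerM) ma fa !hornerC.
rewrite ?(mul0r, mulr0, add0r, addr0) => E.
have : c * (f^`().[a] * b + g.[a]) = 0; last by move/eqP; rewrite mulf_eq0 (negPf c0) => /eqP.
rewrite -E mulrDr mulrBl addrACA -opprD.
set z := (X in _ - X); suff -> : z = 0 by rewrite subr0 mulrA.
by rewrite /z -!mulrA -!mulrDr dam !mulr0.
Qed.

End Adjoin.

(** Zorn's lemma gives a maximal graph. It is defined everywhere, since at a missing point [a] it
    could be enlarged: a relation of minimal degree forces the value if [a] is algebraic over the
    domain, and otherwise the value [0] will do. *)
Lemma derivation_extension (G : set (K * K)) :
  derivation_graph G -> exists D, derivation D /\ forall u, G u -> D u.1 = u.2.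
Proof.
move=> grG.
(* Zorn is applied to the sets [X] to be added to [G], so that the empty chain has the upper bound
   [G] itself. *)
have [F tot totF|A [grA maxA]] :=
    @Zorn_bigcup (K * K)%type [set X | derivation_graph (G `|` X)].
  set U := \bigcup_(X in F) X.
  have mono X : F X -> G `|` X `<=` G `|` U.
    by move=> FX u [|h]; [left|right; exists X].
  have two u v : (G `|` U) u -> (G `|` U) v ->
      exists2 Y, derivation_graph (G `|` Y) & [/\ G `|` Y `<=` G `|` U, (G `|` Y) u & (G `|` Y) v].
    move=> [hu|[X FX hu]] [hv|[Y FY hv]].
    - by exists set0; rewrite ?setU0 //; split => // w ?; left.
    - by exists Y; [apply: tot | split; [apply: mono| left | right]].
    - by exists X; [apply: tot | split; [apply: mono| right | left]].
    - have [XY|YX] := totF _ _ FX FY.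
        by exists Y; [apply: tot | split; [apply: mono| right; apply: XY | right]].
      by exists X; [apply: tot | split; [apply: mono| right | right; apply: YX]].
  split.
  - by left; case: grG.
  - move=> u v /two h /h [Y [_ hB _ _] [sub hu hv]]; exact/sub/hB.
  - move=> u v /two h /h [Y [_ _ hM _] [sub hu hv]]; exact/sub/hM.
  - move=> b h; have [Y [_ _ _ hf] [_ hu _]] := two _ _ h h; exact: hf.
set M := G `|` A in grA.
have ext a b : derivation_graph (adjoin_graph M a b) -> exists c, M (a, c).
  move=> gr; exists b; apply: contrapT => nM.
  pose B := adjoin_graph M a b.
  have sub : M `<=` B := adjoin_graph_sup a b grA.
  have AB : A `<` B.
    split=> [u Au|BA]; first by apply: sub; right.
    by apply: nM; right; apply: BA; apply: adjoin_graph_gen grA.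
  apply: (maxA B AB) => /=.
  by rewrite setUidr // => u Gu; apply: sub; left.
have tot a : exists c, M (a, c).
  pose bad n := `[< exists f g : {poly K}, [/\ poly_graph M f g, f != 0, f.[a] = 0 & size f = n] >].
  have [ex|nex] := pselect (exists n, bad n).
    have [n /asboolP[m [m' [hm m0 ma sm]]] nmin] := ex_minnP ex.
    have [] := @adjoin_graph_minimal M a (- m'.[a] / m^`().[a]) grA m m' hm m0 ma.
      by move=> f g hf f0 fa; rewrite sm; apply: nmin; apply/asboolP; exists f, g.
    by move=> _ /(_ erefl) H; apply: ext; apply: adjoin_graph_derivation grA H.
  apply: (ext a 0); apply: (adjoin_graph_derivation grA) => f g hg fa.
  have f0 : f = 0.
    apply/eqP; apply: contrapT => /negP f0; apply: nex; exists (size f).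
    by apply/asboolP; exists f, g.
  have g0 : g = 0.
    apply/polyP => i; rewrite coef0; case: grA => _ _ _; apply.
    by have := hg i; rewrite f0 coef0.
  by rewrite f0 g0 deriv0 !horner0 mul0r addr0.
pose D a := projT1 (cid (tot a)).
have DP a : M (a, D a) by apply: (projT2 (cid (tot a))).
have uniqM a c d : M (a, c) -> M (a, d) -> c = d.
  case: grA => _ hB _ hf h1 h2; have := hB _ _ h1 h2; rewrite /= subrr.
  by move=> /hf /eqP; rewrite subr_eq0 => /eqP.
have M0 : M (0, 0).
  by case: grA => h1 hB _ _; have := hB _ _ h1 h1; rewrite /= !subrr.
exists D; split; last by move=> [x y] h; apply: uniqM (DP x) _; left.
case: grA => _ hB hM _; split=> x y; apply: uniqM (DP _) _; last first.
  exact: hM (DP x) (DP y).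
have := hB _ _ (DP x) (hB _ _ M0 (DP y)).
by rewrite /= !sub0r !opprK.
Qed.

End DerivationExtension.

Section DerivationTheory.
Variables (K : numFieldType) (D : K -> K).
Hypothesis derD : derivation D.

Lemma derivationD x y : D (x + y) = D x + D y. Proof. by case: derD. Qed.
Lemma derivationM x y : D (x * y) = D x * y + x * D y. Proof. by case: derD. Qed.
Lemma derivation0 : D 0 = 0.
Proof. by apply: (addrI (D 0)); rewrite -derivationD !addr0. Qed.
Lemma derivation1 : D 1 = 0.
Proof. by apply: (addrI (D 1)); rewrite -{3}(mulr1 1) derivationM !(mulr1, mul1r) addr0. Qed.
Lemma derivationN x : D (- x) = - D x.
Proof. by apply/eqP; rewrite -addr_eq0 -derivationD addNr derivation0. Qed.
Lemma derivation_sum (I : Type) (r : seq I) (P : pred I) (F : I -> K) :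
  D (\sum_(i <- r | P i) F i) = \sum_(i <- r | P i) D (F i).
Proof. by apply: (big_morph D derivationD derivation0). Qed.
Lemma derivation_nat n : D n%:R = 0.
Proof.
by elim: n => [|n IH]; rewrite ?derivation0 // -natr1 derivationD IH derivation1 addr0.
Qed.

End DerivationTheory.

(** * Points with dual derivations over an uncountable field *)

Section GenericPoint.
Variable K : numClosedFieldType.
Hypothesis uncountableK : forall f : nat -> K, exists a, forall n, f n <> a.

Definition countable_subring (A : set K) : Prop :=
  [/\ A 1, (forall x y, A x -> A y -> A (x - y)),
      (forall x y, A x -> A y -> A (x * y))
    & exists f : nat -> K, forall x, A x -> exists n, f n = x].

Section Fixed.
Variable A : set K.
Hypothesis ringA : countable_subring A.

Let A1 : A 1. Proof. by case: ringA. Qed.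
Let AB x y : A x -> A y -> A (x - y). Proof. by case: ringA => _ h _ _; apply: h. Qed.
Let AM x y : A x -> A y -> A (x * y). Proof. by case: ringA => _ _ h _; apply: h. Qed.
Let A0 : A 0. Proof. by rewrite -(subrr 1); apply: AB. Qed.

Definition ring_adjoin (a : K) : set K :=
  [set x | exists2 g : {poly K}, (forall i, A g`_i) & x = g.[a]].

Let seq_code (f : nat -> K) (hf : forall x, A x -> exists n, f n = x) (g : {poly K}) :
  (forall i, A g`_i) -> exists s, g = Poly (map f s).
Proof.
move=> hg; suff [s es] : exists s, polyseq g = map f s.
  by exists s; rewrite -es polyseqK.
have : {in polyseq g, forall x, A x} by move=> x /(nthP 0)[i _ <-]; apply: hg.
elim: (polyseq g) => [|x s IH] h; first by exists [::].
have [|t ->] := IH; first by move=> y ys; apply: h; rewrite inE ys orbT.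
have [n <-] := hf x (h _ (mem_head _ _)).
by exists (n :: t).
Qed.

Lemma ring_adjoin_sup a : A `<=` ring_adjoin a.
Proof.
move=> x Ax; exists x%:P; last by rewrite hornerC.
by move=> i; rewrite coefC; case: ifP.
Qed.

Lemma ring_adjoin_gen a : ring_adjoin a a.
Proof.
exists 'X; last by rewrite hornerX.
by move=> i; rewrite coefX; case: (_ == _).
Qed.

Lemma ring_adjoin_countable a : countable_subring (ring_adjoin a).
Proof.
split.
- exact: ring_adjoin_sup.
- move=> _ _ [f hf ->] [g hg ->]; exists (f - g); last by rewrite hornerD hornerN.
  by move=> i; rewrite coefB; apply: AB.
- move=> _ _ [f hf ->] [g hg ->]; exists (f * g); last by rewrite hornerM.
  move=> i; rewrite coefM; elim/big_ind: _ => // [x y hx hy|j _]; last exact: AM.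
  by rewrite -[y]opprK -(sub0r y); apply: AB => //; apply: AB.
- have [_ _ _ [f hf]] := ringA.
  exists (fun n => (Poly (map f (odflt [::] (unpickle n)))).[a]) => _ [g hg ->].
  have [s ->] := seq_code hf hg.
  by exists (pickle s); rewrite pickleK.
Qed.

(** There are countably many polynomials over the countable ring [A], each with finitely many roots.
    The function [h] below enumerates all these roots, and [a] is a value that it misses. *)
Lemma transcendental_exists :
  exists a, forall g : {poly K}, (forall i, A g`_i) -> g.[a] = 0 -> g = 0.
Proof.
have [_ _ _ [f hf]] := ringA.
pose rts (g : {poly K}) := sval (closed_field_poly_normal g).
have rtsP g : g = lead_coef g *: \prod_(z <- rts g) ('X - z%:P).
  exact: (svalP (closed_field_poly_normal g)).
pose h n := let sk := odflt ([::], 0%N) (unpickle n : option (seq nat * nat)) in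
  (rts (Poly (map f sk.1)))`_sk.2.
have [a ha] := uncountableK h; exists a => g hg ga.
apply/eqP; apply: contrapT => /negP g0.
have [s es] := seq_code hf hg.
have : a \in rts g.
  move: ga; rewrite {1}(rtsP g) hornerZ => /eqP.
  by rewrite mulf_eq0 lead_coef_eq0 (negPf g0) /= -rootE root_prod_XsubC.
move=> /(nthP 0)[i _ ei]; apply: (ha (pickle (s, i))).
by rewrite /h pickleK /= -es.
Qed.

End Fixed.

Lemma countable_subring_exists (S : seq K) :
  exists2 A, countable_subring A & {in S, forall c, A c}.
Proof.
elim: S => [|c S [A hA SA]].
  exists [set x | exists z : int, x = z%:~R] => //; split.
  - by exists 1; rewrite mulr1z.
  - by move=> _ _ [y ->] [z ->]; exists (y - z); rewrite intrB.
  - by move=> _ _ [y ->] [z ->]; exists (y * z); rewrite intrM.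
  - exists (fun n => (odflt (0 : int) (unpickle n))%:~R) => _ [z ->].
    by exists (pickle z); rewrite pickleK.
exists (ring_adjoin A c); first exact: ring_adjoin_countable.
move=> x; rewrite inE => /orP[/eqP ->|/SA]; first exact: ring_adjoin_gen.
exact: ring_adjoin_sup.
Qed.

(** Induction on [n], carrying a countable ring [A] that contains [S] and the coordinates chosen so
    far. The next coordinate is transcendental over [A], so some derivation [E] vanishes on [A] and
    takes the value [1] there. *)
Lemma generic_point (S : seq K) n :
  exists (p : 'I_n -> K) (D : 'I_n -> K -> K),
  [/\ forall i, derivation (D i), forall i j, D i (p j) = (i == j)%:R
    & forall i, {in S, forall c, D i c = 0}].
Proof.
suff [A [p [D [_ SA hp [hD hDp hDA]]]]] : exists A (p : nat -> K) (D : nat -> K -> K),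
  [/\ countable_subring A, {in S, forall c, A c}, forall j, (j < n)%N -> A (p j) &
   [/\ forall i, derivation (D i),
     forall i j, (i < n)%N -> (j < n)%N -> D i (p j) = (i == j)%:R
    & forall i, (i < n)%N -> {in S, forall c, D i c = 0}]].
  exists (fun i => p i), (fun i => D i); split=> // [i j|i]; first exact: hDp.
  exact: hDA.
elim: n => [|n [A [p [D [hA SA hp [hD hDp hDS]]]]]].
  have [A hA SA] := countable_subring_exists S.
  by exists A, (fun=> 0), (fun _ _ => 0); split=> //; split=> // i; split=> x y;
     rewrite ?addr0 // mulr0 mul0r addr0.
have [a ha] := transcendental_exists hA.
have [A1 AB AM _] := hA.
have A0 : A 0 by rewrite -(subrr 1); apply: AB.
pose G0 : set (K * K) := [set u | A u.1 /\ u.2 = 0].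
have grG0 : derivation_graph G0.
  split=> //=.
  - by move=> [x y] [z t] [/= Ax ->] [/= Az ->]; split; rewrite ?subrr //; apply: AB.
  - by move=> [x y] [z t] [/= Ax ->] [/= Az ->]; split; rewrite ?mul0r ?mulr0 ?addr0 //; apply: AM.
  - by move=> b [].
have grG : derivation_graph (adjoin_graph G0 a 1).
  apply: adjoin_graph_derivation => // f g hg fa.
  have f0 : f = 0 by apply: ha fa => i; case: (hg i).
  have g0 : g = 0 by apply/polyP => i; rewrite coef0; case: (hg i).
  by rewrite f0 g0 deriv0 !horner0 mul0r addr0.
have [E [dE hE]] := derivation_extension grG.
have EA x : A x -> E x = 0.
  by move=> Ax; apply: (hE (x, 0)); apply: adjoin_graph_sup.
have Ea : E a = 1 by apply: (hE (a, 1)); apply: adjoin_graph_gen.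
(* Subtracting [D i a * E] makes the old derivations vanish at the new coordinate [a]. It does not
   change them on [A], where [E] vanishes. *)
exists (ring_adjoin A a), (fun j => if (j < n)%N then p j else a),
  (fun i => if (i < n)%N then (fun x => D i x - D i a * E x) else E).
have ltS j : (j < n.+1)%N -> (j < n)%N = false -> j = n.
  by rewrite ltnS => le1 /negbT; rewrite -leqNgt => le2; apply/eqP; rewrite eqn_leq le1.
split.
- exact: ring_adjoin_countable.
- by move=> c /SA Ac; apply: (ring_adjoin_sup hA).
- move=> j _; case: ifP => [/hp|_]; last exact: ring_adjoin_gen.
  exact: ring_adjoin_sup.
split.
- move=> i; case: ifP => // _; split=> x y.
    by rewrite (derivationD (hD i)) (derivationD dE) mulrDr opprD addrACA.
  rewrite (derivationM (hD i)) (derivationM dE) mulrDr opprD addrACA !mulrA.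
  by rewrite mulrBl mulrBr !mulrA (mulrC x (D i a)).
- move=> i j li lj; case: ifP => ci; case: ifP => cj.
  + by rewrite hDp // EA ?mulr0 ?subr0 //; apply: hp.
  + by rewrite Ea mulr1 subrr (ltS j lj cj) (ltn_eqF ci).
  + by rewrite EA ?(ltS i li ci) ?(gtn_eqF cj) //; apply: hp.
  + by rewrite Ea (ltS i li ci) (ltS j lj cj) eqxx.
- move=> i li c cS; case: ifP => ci; last by rewrite EA //; apply: SA.
  by rewrite hDS // EA ?mulr0 ?subr0 //; apply: SA.
Qed.

End GenericPoint.

(* Cantor's nested intervals; each step keeps an outer third that misses [f n]. *)
Lemma real_uncountable (R : realType) (f : nat -> R) : exists a, forall n, f n <> a.
Proof.
pose step (c : R) (I : R * R) : R * R :=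
  if c < (I.1 + 2 * I.2) / 3 then ((I.1 + 2 * I.2) / 3, I.2) else (I.1, (2 * I.1 + I.2) / 3).
pose I := fix I n := if n is n'.+1 then step (f n') (I n') else (0, 1 : R).
have lt_I n : (I n).1 < (I n).2.
  by elim: n => [|n IH] /=; [lra | rewrite /step; case: ifP => _ /=; lra].
have step_I n : (I n).1 <= (I n.+1).1 /\ (I n.+1).2 <= (I n).2.
  by have := lt_I n; rewrite /= /step; case: ifP => _ /=; lra.
have out n : f n < (I n.+1).1 \/ (I n.+1).2 < f n.
  have := lt_I n; rewrite /= /step; case: ifP => [h _|/negbT]; first by left.
  by rewrite -leNgt => h hI; right; rewrite /=; lra.
have mono1 n m : (n <= m)%N -> (I n).1 <= (I m).1.
  by elim: m => [|m IH]; rewrite leq_eqVlt => /orP[/eqP -> //|//]; rewrite ltnS => /IH h;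
     have := step_I m; lra.
have mono2 n m : (n <= m)%N -> (I m).2 <= (I n).2.
  by elim: m => [|m IH]; rewrite leq_eqVlt => /orP[/eqP -> //|//]; rewrite ltnS => /IH h;
     have := step_I m; lra.
have le12 n m : (I n).1 <= (I m).2.
  have := lt_I (maxn n m); have := mono1 _ _ (leq_maxl n m); have := mono2 _ _ (leq_maxr n m).
  lra.
pose E : set R := [set (I n).1 | n in setT].
have ubE m : ubound E (I m).2 by move=> _ [n _ <-]; apply: le12.
have E0 : E !=set0 by exists (I 0%N).1, 0%N.
exists (sup E) => n fn.
have h1 : (I n.+1).1 <= sup E.
  by apply: ub_le_sup; [exists (I 0%N).2; apply: ubE | exists n.+1].
have h2 : sup E <= (I n.+1).2 by apply: ge_sup.
by case: (out n); rewrite fn => h; lra.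
Qed.

Lemma complex_uncountable (R : realType) (f : nat -> R[i]) : exists a, forall n, f n <> a.
Proof.
have [a ha] := real_uncountable (fun n => complex.Re (f n)).
by exists (a%:C)%C => n fn; apply: (ha n); rewrite fn.
Qed.

(** * The chain rule, and nonvanishing of polynomials at a point with dual derivations *)

Lemma derivation_meval (K : numFieldType) n (D : K -> K) (p : 'I_n -> K)
    (P : {mpoly K[n]}) :
  derivation D -> (forall m, D P@_m = 0) ->
  D P.@[p] = \sum_j P^`M(j).@[p] * D (p j).
Proof.
move=> hD; pose ok (Q : {mpoly K[n]}) := D Q.@[p] = \sum_j Q^`M(j).@[p] * D (p j).
have okD Q1 Q2 : ok Q1 -> ok Q2 -> ok (Q1 + Q2).
  rewrite /ok mevalD (derivationD hD) => -> ->; rewrite -big_split /=.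
  by apply: eq_bigr => j _; rewrite mderivD mevalD mulrDl.
have okM Q1 Q2 : ok Q1 -> ok Q2 -> ok (Q1 * Q2).
  rewrite /ok mevalM (derivationM hD) => -> ->; rewrite mulr_suml mulr_sumr -big_split /=.
  by apply: eq_bigr => j _; rewrite mderivM mevalD !mevalM mulrDl mulrA mulrAC.
have okC c : D c = 0 -> ok c%:MP.
  by move=> h; rewrite /ok mevalC h big1 // => j _; rewrite mderivC meval0 mul0r.
have okX i : ok 'X_i.
  rewrite /ok mevalXU (bigD1 i) //= big1 => [|j ji].
    rewrite mderivX mnm1E eqxx scale1r; have -> : (U_(i) - U_(i))%MM = 0%MM :> 'X_{1..n}.
      by apply/mnmP => k; rewrite mnmBE subnn mnm0E.
    by rewrite mpolyX0 meval1 mul1r addr0.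
  by rewrite mderivX mnm1E eq_sym (negPf ji) scale0r meval0 mul0r.
have okXm m : ok 'X_[m].
  rewrite mpolyXE_id; elim/big_ind: _ => [|//|i _]; first by apply/okC/derivation1.
  elim: (m i) => [|k IH]; first by rewrite expr0; apply/okC/derivation1.
  by rewrite exprS; apply: okM.
move=> cP; rewrite -/(ok P) (mpolyE P); elim/big_ind: _ => [|//|m _].
  exact/okC/derivation0.
by rewrite -mul_mpolyC; apply: okM => //; apply: okC.
Qed.

Lemma msize_mderiv_lt n (R : nzRingType) (P : {mpoly R[n]}) i :
  P != 0 -> (msize P^`M(i) < msize P)%N.
Proof.
move=> P0; have [->|Q0] := eqVneq P^`M(i) 0; first by rewrite msize0 lt0n msize_poly_eq0.
have : mlead P^`M(i) \in msupp P^`M(i) by apply: mlead_supp.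
rewrite mcoeff_msupp mcoeff_mderiv => h; rewrite -(mlead_deg Q0).
have : (mlead P^`M(i) + U_(i))%MM \in msupp P.
  by rewrite mcoeff_msupp; apply: contraNneq h => ->; rewrite mul0rn.
by move/msize_mdeg_lt; rewrite mdegD mdeg1 addn1.
Qed.

(** If [P] vanishes at [p], applying [D i] shows that its [i]-th partial derivative does too. By
    induction on the size all partial derivatives are zero, so [P] is a constant that vanishes at
    [p]. *)
Lemma generic_meval_neq0 (K : numFieldType) n (D : 'I_n -> K -> K) (p : 'I_n -> K)
    (P : {mpoly K[n]}) :
  (forall i, derivation (D i)) -> (forall i j, D i (p j) = (i == j)%:R) ->
  (forall i m, D i P@_m = 0) -> P != 0 -> P.@[p] != 0.
Proof.
move=> hD hp; have [k] := ubnP (msize P); elim: k P => // k IH P.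
rewrite ltnS => sP cP P0; apply: contra_neq P0 => Pp.
have dP i : P^`M(i) = 0.
  apply/eqP; apply: contraTT isT => d0; have := IH P^`M(i).
  rewrite d0; have -> : P^`M(i).@[p] = 0.
    have := derivation_meval p (hD i) (cP i); rewrite Pp (derivation0 (hD i)).
    rewrite (bigD1 i) //= hp eqxx mulr1 big1 ?addr0 // => j ji.
    by rewrite hp eq_sym (negPf ji) mulr0.
  rewrite eqxx; apply=> //.
    apply: leq_trans sP; apply: msize_mderiv_lt.
    by apply: contra_neq d0 => ->; rewrite mderiv0.
  move=> j m; rewrite mcoeff_mderiv -mulr_natr (derivationM (hD j)) cP mul0r.
  by rewrite (derivation_nat (hD j)) mulr0 addr0.
suff PC : P = (P@_0)%:MP by move: Pp; rewrite PC mevalC => ->; rewrite mpolyC0.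
apply/mpolyP => m; rewrite mcoeffC; have [->|m0] := eqVneq m 0%MM.
  by rewrite mulr1.
have [i mi] : exists i, (0 < m i)%N.
  apply/existsP; apply: contraNT m0; rewrite negb_exists => /forallP h.
  by apply/eqP/mnmP => i; rewrite mnm0E; apply/eqP; rewrite -leqn0 leqNgt h.
have := mcoeff_mderiv i P (m - U_(i))%MM; rewrite dP mcoeff0.
rewrite submK; last by apply/mnm_lepP => j; rewrite mnm1E; case: eqP => // <-.
by move/esym/eqP; rewrite mulrn_eq0 /= mulr0 => /eqP.
Qed.

(** * Moments as polynomials *)

(* In the coordinates (mu, nu) = (mu, mu^2 / lambda), resp.
   (kappa * theta, theta), the moments become polynomials, the r-th one
   homogeneous of degree r with leading term mu^r. *)
Fixpoint inverse_gaussian_mpoly (K : fieldType) (r : nat) {struct r} : {mpoly K[2]} :=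
  if r is r1.+1 then
    if r1 is r2.+1 then
      'X_1 * inverse_gaussian_mpoly K r1 *+ (2 * r2).+1
        + 'X_0 * 'X_0 * inverse_gaussian_mpoly K r2
    else 'X_0
  else 1.

Fixpoint gamma_mpoly (K : fieldType) (r : nat) : {mpoly K[2]} :=
  if r is r1.+1 then ('X_0 + 'X_1 *+ r1) * gamma_mpoly K r1 else 1.

Definition moment_mpoly (K : fieldType) (D : distribution) (r : nat) : {mpoly K[2]} :=
  match D with
  | InverseGaussian => inverse_gaussian_mpoly K r
  | Gamma => gamma_mpoly K r
  end.

Definition moment_coords (K : fieldType) (D : distribution) (t : K * K) : K * K :=
  match D with
  | InverseGaussian => (t.1, t.1 ^+ 2 / t.2)
  | Gamma => (t.1 * t.2, t.2)
  end.

Definition pair_fun (T : Type) (x : T * T) : 'I_2 -> T :=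
  fun j => if j == 0 then x.1 else x.2.

Lemma nat_ind2 (P : nat -> Prop) :
  P 0%N -> P 1%N -> (forall r, P r -> P r.+1 -> P r.+2) -> forall r, P r.
Proof.
move=> h0 h1 h2 r; suff [] : P r /\ P r.+1 by [].
by elim: r => [//|r [hr hr1]]; split=> //; apply: h2.
Qed.

Lemma inverse_gaussian_mpolyE (K : fieldType) r :
  inverse_gaussian_mpoly K r.+2 =
  'X_1 * inverse_gaussian_mpoly K r.+1 *+ (2 * r).+1
    + 'X_0 * 'X_0 * inverse_gaussian_mpoly K r.
Proof. by []. Qed.

Lemma moment_mpolyP (K : fieldType) (D : distribution) (t : K * K) r :
  moments_defined D t ->
  moment D t r = (moment_mpoly K D r).@[pair_fun (moment_coords D t)].
Proof.
case: D => [|_] /=.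
  move=> /eqP l0; elim/nat_ind2: r => [||r IH1 IH2].
  - by rewrite meval1.
  - by rewrite mevalXU.
  rewrite inverse_gaussian_mpolyE mevalD mevalMn !mevalM !mevalXU /pair_fun /= -IH1 -IH2.
  rewrite -[X in _ * X + _]/(inverse_gaussian_moment t.1 t.2 r.+1) -expr2; congr (_ + _).
  have -> : (2 * r.+2)%N%:R - 3%:R = (2 * r).+1%:R :> K.
    have -> : (2 * r.+2 = (2 * r).+1 + 3)%N by rewrite addSnnS [RHS]addnC !mulnS.
    by rewrite natrD addrK.
  rewrite -[RHS]mulr_natl; field => //.
rewrite /gamma_moment; elim: r => [|r IH] /=; first by rewrite big_nil expr0 mulr1 meval1.
rewrite big_nat_recr //= mevalM -IH mevalD mevalMn !mevalXU /pair_fun /=.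
by rewrite exprS -mulr_natr; ring.
Qed.

(** Integers are killed by every derivation, so the chain rule applies to the moment polynomials. *)
Lemma moment_mpoly_int (K : fieldType) (D : distribution) r :
  exists Q : {mpoly int[2]}, moment_mpoly K D r = map_mpoly intr Q.
Proof.
have X i : 'X_i = map_mpoly intr 'X_i :> {mpoly K[2]} by rewrite map_mpolyX.
case: D; rewrite /moment_mpoly.
  elim/nat_ind2: r => [||r [Q hQ] [Q1 hQ1]].
  - by exists 1; rewrite rmorph1.
  - by exists 'X_0; rewrite /= X.
  exists ('X_1 * Q1 *+ (2 * r).+1 + 'X_0 * 'X_0 * Q).
  by rewrite inverse_gaussian_mpolyE hQ hQ1 !X rmorphD rmorphMn !rmorphM.
elim: r => [|r [Q hQ]]; first by exists 1; rewrite rmorph1.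
exists (('X_0 + 'X_1 *+ r) * Q).
by rewrite /= hQ !X rmorphM rmorphD rmorphMn.
Qed.

Lemma moment_mpoly0 (K : fieldType) D : moment_mpoly K D 0 = 1.
Proof. by case: D. Qed.

Lemma moment_mpoly1 (K : fieldType) D : moment_mpoly K D 1 = 'X_0.
Proof. by case: D => //=; rewrite mulr0n addr0 mulr1. Qed.

Lemma moment_mpoly2 (K : fieldType) D : moment_mpoly K D 2 = 'X_0 * ('X_0 + 'X_1).
Proof. by case: D => /=; ring. Qed.

Section Jets.
Variables (K : numFieldType) (t : K).
Hypothesis t0 : t != 0.

Let pt := pair_fun (t, 0).

(** At [nu = 0] the moment vector is a point of the rational normal curve. The factors in front of
    [t ^+ r] are polynomials in [r] of degrees 0, 1, 2, 3 and 4, so the five jets span the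
    osculating space of order four. The two distributions differ only in the last factor. *)
Lemma moment_jets D r : let P := moment_mpoly K D r in
  [/\ P.@[pt] = t ^+ r, P^`M(0).@[pt] * t = r%:R * t ^+ r,
      P^`M(1).@[pt] * t * 2%:R = r%:R * (r%:R - 1) * t ^+ r,
      P^`M(1)^`M(0).@[pt] * t ^+ 2 * 2%:R = r%:R * (r%:R - 1) ^+ 2 * t ^+ r
    & P^`M(1)^`M(1).@[pt] * t ^+ 2 * 4%:R = r%:R * (r%:R - 1) * (r%:R - 2%:R) *
        (r%:R - 3%:R + (if D is Gamma then 8%:R / 3%:R else 4%:R)) * t ^+ r].
Proof.
have X01 : ('X_0 : {mpoly K[2]})^`M(1) = 0 by rewrite mderivX mnm1E scale0r.
have X10 : ('X_1 : {mpoly K[2]})^`M(0) = 0 by rewrite mderivX mnm1E scale0r.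
have Xii i : ('X_i : {mpoly K[2]})^`M(i) = 1.
  rewrite mderivX mnm1E eqxx scale1r; have -> : (U_(i) - U_(i))%MM = 0%MM :> 'X_{1..2}.
    by apply/mnmP => k; rewrite mnmBE subnn mnm0E.
  by rewrite mpolyX0.
have d1 i : (1 : {mpoly K[2]})^`M(i) = 0 by rewrite mderivC.
pose E := (inverse_gaussian_mpolyE, mderivD, mderivM, mderivMn, X01, X10, Xii, d1, mderiv0,
  mevalD, mevalM, mevalMn, mevalXU, meval0, meval1).
case: D; rewrite /moment_mpoly /=.
  elim/nat_ind2: r => [||r].
  - by rewrite !E !mul0r !expr0.
  - rewrite !E /pt /pair_fun /= subrr ?(mul0r, mulr0, expr1, mul1r) expr2 ?mul0r; split => //.
  set P := inverse_gaussian_mpoly K r; set P1 := inverse_gaussian_mpoly K r.+1.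
  move=> [a0 a1 a2 a3 a4] [b0 b1 b2 b3 b4].
  rewrite !E; rewrite -/P -/P1 /pt /pair_fun /= -/pt.
  have Er2 : r.+2%:R = r%:R + 2%:R :> K by rewrite -natrD addn2.
  have Er1 : r.+1%:R = r%:R + 1 :> K by rewrite natr1.
  have E2r : forall x : K, x *+ (2 * r)%N.+1 = (2%:R * r%:R + 1) * x.
    by move=> x; rewrite -[LHS]mulr_natl -[(2 * r)%N.+1%:R]natr1 natrM.
  have div2 (x y : K) : x * t * 2%:R = y -> x = y / t / 2%:R.
    by move=> <-; field.
  have div3 (x y : K) n : x * t ^+ 2 * n.+1%:R = y -> x = y / t ^+ 2 / n.+1%:R.
    have: n.+1%:R != 0 :> K by rewrite pnatr_eq0.
    by move: (n.+1%:R : K) => N hN <-; field; rewrite t0 hN.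
  have div1 (x y : K) : x * t = y -> x = y / t.
    by move=> <-; field.
  rewrite a0 b0 (div1 _ _ a1) (div1 _ _ b1) (div2 _ _ a2) (div2 _ _ b2).
  rewrite (div3 _ _ _ a3) (div3 _ _ _ b3) (div3 _ _ _ a4) (div3 _ _ _ b4).
  rewrite !E2r !(exprS _ r.+1) !(exprS _ r) Er1 Er2 ?expr2; move: (t ^+ r) (r%:R : K) => T s.
  rewrite !(mul0r, mulr0, add0r, addr0, mul1r, mulr1, expr0).
  by split; field.
elim: r => [|r].
  by rewrite !E !mul0r !expr0.
set P := gamma_mpoly K r.
move=> [a0 a1 a2 a3 a4].
rewrite /= !E -/P /pt /pair_fun /= -/pt.
have Er1 : r.+1%:R = r%:R + 1 :> K by rewrite natr1.
have Er : 0 *+ r = 0 :> K by rewrite mul0rn.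
have div2 (x y : K) : x * t * 2%:R = y -> x = y / t / 2%:R.
  by move=> <-; field.
have div3 (x y : K) n : x * t ^+ 2 * n.+1%:R = y -> x = y / t ^+ 2 / n.+1%:R.
  have: n.+1%:R != 0 :> K by rewrite pnatr_eq0.
    by move: (n.+1%:R : K) => N hN <-; field; rewrite t0 hN.
have div1 (x y : K) : x * t = y -> x = y / t.
  by move=> <-; field.
rewrite a0 (div1 _ _ a1) (div2 _ _ a2) (div3 _ _ _ a3) (div3 _ _ _ a4).
rewrite ?Er !(exprS _ r) Er1 ?expr2; move: (t ^+ r) (r%:R : K) => T s.
rewrite !(mul0r, mulr0, add0r, addr0, mul1r, mulr1, expr0).
by split; field.
Qed.

End Jets.

(** * Hermite interpolation *)

Section Hermite.
Variable K : numFieldType.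

(** In characteristic zero, differentiation lowers the multiplicity of a root by exactly one. *)
Lemma dvdp_XsubC_exp_deriv (p : {poly K}) t m :
  p.[t] = 0 -> ('X - t%:P) ^+ m %| p^`() -> ('X - t%:P) ^+ m.+1 %| p.
Proof.
move=> pt; have [->|p0] := eqVneq p 0; first by rewrite dvdp0.
have [e [q]] := multiplicity_XsubC p t; rewrite p0 /= => qt ep.
case: e ep => [|e] ep.
  by move: qt pt; rewrite ep expr0 mulr1 rootE => /negPf h /eqP; rewrite h.
have -> : p^`() = (q^`() * ('X - t%:P) + q *+ e.+1) * ('X - t%:P) ^+ e.
  by rewrite {1}ep derivM deriv_exp derivXsubC mul1r mulrDl -mulrA -exprS mulrnAl mulrnAr.
move=> dv; have le_me : (m <= e)%N.
  rewrite leqNgt; apply/negP => lt; move: dv.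
  have -> : (m = (m - e.+1) + 1 + e)%N by rewrite -addnA add1n subnK.
  rewrite exprD dvdp_mul2r ?expf_neq0 ?polyXsubC_eq0 // exprD expr1.
  move/(dvdp_trans (dvdp_mull _ (dvdpp _))).
  rewrite dvdp_XsubCl rootE hornerD hornerM hornerMn hornerXsubC subrr mulr0 add0r.
  by rewrite mulrn_eq0 /= -rootE (negPf qt).
by rewrite ep dvdp_mull // dvdp_exp2l.
Qed.

Lemma dvdp_XsubC_exp (p : {poly K}) t m :
  (forall j, (j < m)%N -> p^`(j).[t] = 0) -> ('X - t%:P) ^+ m %| p.
Proof.
elim: m p => [|m IH] p h; first by rewrite expr0 dvd1p.
apply: dvdp_XsubC_exp_deriv; first exact: (h 0%N).
by apply: IH => j jm; rewrite -derivSn; apply: h.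
Qed.

Lemma dvdp_prod_XsubC_exp (I : eqType) (s : seq I) (t : I -> K) (m : I -> nat)
    (p : {poly K}) :
  uniq s -> injective t -> (forall i, ('X - (t i)%:P) ^+ m i %| p) ->
  \prod_(i <- s) ('X - (t i)%:P) ^+ m i %| p.
Proof.
move=> us inj_t h; elim: s us => [|i s IH]; first by rewrite big_nil dvd1p.
rewrite cons_uniq big_cons => /andP[nis us].
rewrite Gauss_dvdp ?h ?IH //; apply: coprimep_expl.
rewrite coprimep_sym coprimep_XsubC rootE horner_prod.
rewrite prodf_seq_neq0; apply/allP => j js /=.
rewrite horner_exp expf_neq0 // hornerXsubC subr_eq0 (inj_eq inj_t).
by apply: contraNneq nis => ->.
Qed.

Lemma falling_factorialS n m :
  (n ^_ m.+1)%:R = (n ^_ m)%:R * (n%:R - m%:R) :> K.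
Proof.
rewrite ffactnSr natrM; have [le|lt] := leqP m n; first by rewrite natrB.
by rewrite ffact_small // !mul0r.
Qed.

(** Read [L] as the coefficients of a polynomial of degree less than [N]. It vanishes to order [m i]
    at [t i], so it is divisible by a product of degree at least [N]. *)
Lemma hermite_interpolation k (t : 'I_k -> K) (m : 'I_k -> nat) N (L : 'I_N -> K) :
  injective t -> (forall i, t i != 0) -> (N <= \sum_i m i)%N ->
  (forall i j, (j < m i)%N -> \sum_(r < N) L r * ((r ^_ j)%:R * t i ^+ r) = 0) ->
  forall r, L r = 0.
Proof.
move=> inj_t t0 leN h.
pose p : {poly K} := \sum_(r < N) L r *: 'X^r.
have dp i j : p^`(j).[t i] * t i ^+ j = \sum_(r < N) L r * ((r ^_ j)%:R * t i ^+ r).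
  rewrite /p raddf_sum /= horner_sum mulr_suml; apply: eq_bigr => r _.
  rewrite derivnZ derivnXn hornerZ hornerMn hornerXn -!mulrA; congr (_ * _).
  rewrite -[X in X * _]mulr_natl -mulrA -exprD; have [le|lt] := leqP j r; first by rewrite subnK.
  by rewrite ffact_small // !mul0r.
have dvp : \prod_i ('X - (t i)%:P) ^+ m i %| p.
  apply: dvdp_prod_XsubC_exp => // [|i]; first exact: index_enum_uniq.
  apply: dvdp_XsubC_exp => j jm; apply: (mulIf (expf_neq0 j (t0 i))).
  by rewrite mul0r dp h.
have p0 : p = 0.
  apply/eqP; apply: contraTT (leN) => p0; rewrite -ltnNge.
  have := dvdp_leq p0 dvp.
  rewrite size_prod => [|i _]; last by rewrite expf_neq0 ?polyXsubC_eq0.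
  have -> : (\sum_i size (('X - (t i)%:P) ^+ m i)%R = \sum_(i < k) (m i + 1))%N.
    by apply: eq_bigr => i _; rewrite size_exp_XsubC addn1.
  rewrite big_split /= sum1_card subSn ?leq_addl // addnK => lt.
  apply: leq_trans lt _; apply/leq_sizeP => j le.
  rewrite coef_sum big1 // => r _; rewrite coefZ coefXn.
  by rewrite gtn_eqF ?mulr0 // (leq_trans (ltn_ord r)).
move=> r; have /polyP/(_ r) := p0; rewrite coef0 coef_sum (bigD1 r) //=.
rewrite coefZ coefXn eqxx mulr1 big1 ?addr0 // => s sr.
by rewrite coefZ coefXn eq_sym (inj_eq val_inj) (negPf sr) mulr0.
Qed.

End Hermite.

(** * Tangent spaces at general points *)

Section DerivationMatrix.
Variables (K : numFieldType) (d : K -> K).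
Hypothesis hd : derivation d.

Lemma derivation_map_mxD m n (A B : 'M[K]_(m, n)) :
  map_mx d (A + B) = map_mx d A + map_mx d B.
Proof. by apply/matrixP => i j; rewrite !mxE (derivationD hd). Qed.

Lemma derivation_mulmx m n p (A : 'M[K]_(m, n)) (B : 'M_(n, p)) :
  map_mx d (A *m B) = map_mx d A *m B + A *m map_mx d B.
Proof.
apply/matrixP => i j; rewrite !mxE (derivation_sum hd) -big_split /=.
by apply: eq_bigr => l _; rewrite !mxE (derivationM hd).
Qed.

End DerivationMatrix.

Definition eval_mx (K : fieldType) k N (Q : nat -> {mpoly K[2]}) (x : 'I_k -> K * K) :
    'M[K]_(k, N) :=
  \matrix_(i < k, r < N) (Q r).@[pair_fun (x i)].

(* Number of rows of the tangent spaces at [k] points, plus two second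
   derivatives at one of them. *)
Notation jet_size k := (k + (k + k) + (1 + 1))%N.

Section MomentMatrices.
Variables (K : numFieldType) (D : distribution) (k : nat).
Implicit Types x y : 'I_k -> K * K.

Let P r := moment_mpoly K D r.

Definition moment_mx := @eval_mx K k (jet_size k) P.
Definition moment_mx1 := @eval_mx K k (jet_size k) (fun r => (P r)^`M(0)).
Definition moment_mx2 := @eval_mx K k (jet_size k) (fun r => (P r)^`M(1)).
Definition moment_mx12 := @eval_mx K k (jet_size k) (fun r => (P r)^`M(1)^`M(0)).
Definition moment_mx22 := @eval_mx K k (jet_size k) (fun r => (P r)^`M(1)^`M(1)).

Definition tangent_mx x : 'M_(k + (k + k), jet_size k) :=
  col_mx (moment_mx x) (col_mx (moment_mx1 x) (moment_mx2 x)).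

(** There are [3k + 2] columns, which makes the matrix square: independence of its rows is the
    nonvanishing of one determinant, a polynomial condition on [x]. *)
Definition jet_mx x (i : 'I_k) : 'M_(jet_size k) :=
  col_mx (tangent_mx x) (col_mx (row i (moment_mx12 x)) (row i (moment_mx22 x))).

Lemma moment_mpoly_const (d : K -> K) r m : derivation d -> d (P r)@_m = 0.
Proof.
move=> hd; have [Q eQ] := moment_mpoly_int K D r; rewrite /P eQ.
rewrite mcoeff_map_mpoly; case: (Q@_m) => n /=; first exact: derivation_nat.
by rewrite NegzE mulrNz (derivationN hd) (derivation_nat hd) oppr0.
Qed.

Lemma mderiv_const n (d : K -> K) (Q : {mpoly K[n]}) i m :
  derivation d -> (forall m', d Q@_m' = 0) -> d (Q^`M(i))@_m = 0.
Proof.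
move=> hd h; rewrite mcoeff_mderiv -mulr_natr (derivationM hd) h mul0r.
by rewrite (derivation_nat hd) mulr0 addr0.
Qed.

Lemma derivation_eval_mx (d : K -> K) N (Q : nat -> {mpoly K[2]}) x :
  derivation d -> (forall r m, d (Q r)@_m = 0) ->
  map_mx d (@eval_mx K k N Q x) =
    diag_mx (\row_i d (x i).1) *m eval_mx N (fun r => (Q r)^`M(0)) x +
    diag_mx (\row_i d (x i).2) *m eval_mx N (fun r => (Q r)^`M(1)) x.
Proof.
move=> hd hQ; apply/matrixP => i r; rewrite mxE !mul_diag_mx !mxE.
rewrite (derivation_meval _ hd (hQ r)) big_ord_recl big_ord1.
have -> : lift ord0 ord0 = 1 :> 'I_2 by apply/val_inj.
by congr (_ + _); rewrite mulrC.
Qed.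

End MomentMatrices.

(** Take distinct nonzero [t i] and [nu = 0]. By [moment_jets], a vector orthogonal to all rows
    satisfies Hermite conditions of order 5 at [t i] and of order 3 at the other points, hence is
    zero. *)
Lemma jet_mx_unit_exists (K : numFieldType) D k :
  exists x : 'I_k -> K * K, forall i, \det (jet_mx D x i) != 0.
Proof.
pose t (i : 'I_k) : K := i.+1%:R.
have t0 i : t i != 0 by rewrite pnatr_eq0.
have inj_t : injective t.
  by move=> i j /eqP; rewrite eqr_nat eqSS => /eqP/val_inj.
exists (fun i => (t i, 0)) => i; rewrite -det_tr; apply/negP => /det0P[L L0 hL].
(* [E j q] says that [L] is orthogonal to the sequence [q r * t j ^+ r]; this is a linear condition
   on [q]. *)
pose E (j : 'I_k) (q : nat -> K) := \sum_(r < jet_size k) L 0 r * (q r * t j ^+ r) = 0.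
have Elin j (c : K) q1 q2 : E j q1 -> E j q2 -> E j (fun r => q1 r * c + q2 r).
  rewrite /E => h1 h2.
  under eq_bigr => r _ do rewrite mulrDl mulrDr mulrAC mulrA.
  by rewrite big_split /= h2 -mulr_suml h1 mul0r addr0.
have Eext j q1 q2 : q1 =1 q2 -> E j q1 -> E j q2.
  by rewrite /E => h e; rewrite -[RHS]e; apply: eq_bigr => r _; rewrite h.
have rowE (a : 'I_(jet_size k)) : \sum_r L 0 r * jet_mx D (fun i => (t i, 0)) i a r = 0.
  have := congr1 (fun M : 'rV_(jet_size k) => M 0 a) hL; rewrite mxE [RHS]mxE => e.
  by rewrite -[RHS]e; apply: eq_bigr => r _; rewrite [in RHS]mxE.
pose pt j := pair_fun (t j, 0 : K).
have scaleE (j : 'I_k) (f : nat -> K) (c : K) (q : nat -> K) :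
    \sum_(r < jet_size k) L 0 r * f r = 0 ->
    (forall r, f r * c = q r * t j ^+ r) -> E j q.
  move=> h1 h2; rewrite /E.
  under eq_bigr => r _ do rewrite -h2 mulrA.
  by rewrite -mulr_suml h1 mul0r.
have E0 j : E j (fun=> 1).
  have := rowE (lshift _ (lshift _ j)); rewrite /jet_mx /tangent_mx.
  under eq_bigr => r _ do rewrite !col_mxEu mxE.
  move=> h; apply: (scaleE j (fun r => (moment_mpoly K D r).@[pt j]) 1 _ h) => r; rewrite mulr1 mul1r.
  by have [] := moment_jets (t0 j) D r.
have E1 j : E j (fun r => r%:R).
  have := rowE (lshift _ (rshift _ (lshift _ j))); rewrite /jet_mx /tangent_mx.
  under eq_bigr => r _ do rewrite col_mxEu col_mxEd col_mxEu mxE.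
  move=> h; apply: (scaleE j (fun r => (moment_mpoly K D r)^`M(0).@[pt j]) (t j) _ h) => r.
  by have [] := moment_jets (t0 j) D r.
have E2 j : E j (fun r => r%:R * (r%:R - 1)).
  have := rowE (lshift _ (rshift _ (rshift _ j))); rewrite /jet_mx /tangent_mx.
  under eq_bigr => r _ do rewrite col_mxEu !col_mxEd mxE.
  move=> h; apply: (scaleE j (fun r => (moment_mpoly K D r)^`M(1).@[pt j]) (t j * 2%:R) _ h) => r; rewrite mulrA.
  by have [] := moment_jets (t0 j) D r.
have E3 : E i (fun r => r%:R * (r%:R - 1) ^+ 2).
  have := rowE (rshift _ (lshift _ 0)); rewrite /jet_mx /tangent_mx.
  under eq_bigr => r _ do rewrite col_mxEd col_mxEu !mxE.
  move=> h; apply: (scaleE i (fun r => (moment_mpoly K D r)^`M(1)^`M(0).@[pt i]) (t i ^+ 2 * 2%:R) _ h) => r; rewrite mulrA.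
  by have [] := moment_jets (t0 i) D r.
pose c : K := if D is Gamma then 8%:R / 3%:R else 4%:R.
have E4 : E i (fun r => r%:R * (r%:R - 1) * (r%:R - 2%:R) * (r%:R - 3%:R + c)).
  have := rowE (rshift _ (rshift _ 0)); rewrite /jet_mx /tangent_mx.
  under eq_bigr => r _ do rewrite !col_mxEd !mxE.
  move=> h; apply: (scaleE i (fun r => (moment_mpoly K D r)^`M(1)^`M(1).@[pt i]) (t i ^+ 2 * 4%:R) _ h) => r; rewrite mulrA.
  by have [] := moment_jets (t0 i) D r.
apply/negP: L0; rewrite negbK; apply/eqP/rowP => r; rewrite mxE.
(* The orders add up to [3 (k - 1) + 5 = 3k + 2], the number of columns. *)
pose m j := if j == i then 5%N else 3%N.
apply: (hermite_interpolation (m := m) inj_t t0).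
  rewrite (bigD1 i) //= /m eqxx.
  rewrite (eq_bigr (fun=> 3%N)) => [|j /negPf -> //].
  rewrite sum_nat_const; have := cardC1 i; rewrite card_ord.
  have -> : #|predC1 i| = #|[pred j | j != i]| by [].
  case: k i {rowE E0 E1 E2 E3 E4 scaleE Eext Elin E m pt hL L r inj_t t0 t} => [[]//|k] i /= ->.
  by lia.
have ff1 n : (n ^_ 1)%:R = n%:R :> K by rewrite ffactn1.
have ff2 n : (n ^_ 2)%:R = n%:R * (n%:R - 1) :> K by rewrite falling_factorialS ff1.
have ff3 n : (n ^_ 3)%:R = n%:R * (n%:R - 1) * (n%:R - 2%:R) :> K.
  by rewrite falling_factorialS ff2.
have ff4 n : (n ^_ 4)%:R = n%:R * (n%:R - 1) * (n%:R - 2%:R) * (n%:R - 3%:R) :> K.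
  by rewrite falling_factorialS ff3.
move=> j; rewrite /m; case: eqP => [->|_] e em; rewrite -/(E _ (fun r => (r ^_ e)%:R));
  (case: e em => [_|e]; first by apply: Eext (E0 _) => n; rewrite ffactn0);
  (case: e => [_|e]; first by apply: Eext (E1 _) => n; rewrite ff1);
  (case: e => [_|e]; first by apply: Eext (E2 _) => n; rewrite ff2); last by [].
(* Passing to falling factorials: [r (r - 1)^2 - r (r - 1) = r (r - 1) (r - 2)], and subtracting [c]
   times this from [E4] leaves the falling factorial of order four. *)
have E3' : E i (fun r => r%:R * (r%:R - 1) * (r%:R - 2%:R)).
  by apply: Eext (Elin i (-1) _ _ (E2 i) E3) => n; ring.
case: e => [_|e]; first by apply: Eext E3' => n; rewrite ff3.
case: e => [_|//].
by apply: Eext (Elin i (- c) _ _ E3' E4) => n; rewrite ff4; ring.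
Qed.

(** * Identifiability of a generic point *)

Section GenericIdentifiability.
Variables (K : numFieldType) (D : distribution) (k : nat).
Variables (x : 'I_k -> K * K) (a : 'I_k -> K).
Variables (dm dn da : 'I_k -> K -> K).
Hypotheses (hdm : forall i, derivation (dm i)) (hdn : forall i, derivation (dn i))
  (hda : forall i, derivation (da i)).
Hypotheses
  (dmE : forall i j, [/\ dm i (x j).1 = (i == j)%:R, dm i (x j).2 = 0 & dm i (a j) = 0])
  (dnE : forall i j, [/\ dn i (x j).1 = 0, dn i (x j).2 = (i == j)%:R & dn i (a j) = 0])
  (daE : forall i j, [/\ da i (x j).1 = 0, da i (x j).2 = 0 & da i (a j) = (i == j)%:R]).
Hypotheses (det0 : forall i, \det (jet_mx D x i) != 0) (a0 : forall i, a i != 0)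
  (x0 : forall i, (x i).1 != 0).

Local Notation V0 := (@moment_mx K D k).
Local Notation V1 := (@moment_mx1 K D k).
Local Notation V2 := (@moment_mx2 K D k).
Local Notation V12 := (@moment_mx12 K D k).
Local Notation V22 := (@moment_mx22 K D k).
Local Notation W := (tangent_mx D x).

Let coefP (d : K -> K) : derivation d -> forall r m, d (moment_mpoly K D r)@_m = 0.
Proof. by move=> hd r m; apply: moment_mpoly_const. Qed.

Let dV0 (d : K -> K) y : derivation d -> map_mx d (V0 y) =
  diag_mx (\row_i d (y i).1) *m V1 y + diag_mx (\row_i d (y i).2) *m V2 y.
Proof. by move=> hd; apply: derivation_eval_mx => // r m; apply: coefP. Qed.

Let diag_delta (i : 'I_k) N (M : 'M[K]_(k, N)) :
  diag_mx (\row_j (i == j)%:R) *m M = delta_mx i 0 *m row i M.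
Proof.
apply/matrixP => j r; rewrite mul_diag_mx !mxE big_ord1 !mxE eqxx andbT.
by rewrite eq_sym; case: eqP => [->|_]; rewrite ?mul1r ?mul0r.
Qed.

Let diag_0 N (M : 'M[K]_(k, N)) : diag_mx (\row_(j < k) 0) *m M = 0.
Proof. by apply/matrixP => j r; rewrite mul_diag_mx !mxE mul0r. Qed.

Let row_ext (f g : 'I_k -> K) : f =1 g -> \row_j f j = \row_j g j :> 'rV_k.
Proof. by move=> h; apply/rowP => j; rewrite !mxE. Qed.

Let dmV0 i : map_mx (dm i) (V0 x) = delta_mx i 0 *m row i (V1 x).
Proof.
rewrite dV0 // (row_ext (f := fun j => dm i (x j).1) (g := fun j => (i == j)%:R)) => [|j]; last by case: (dmE i j).
rewrite (row_ext (f := fun j => dm i (x j).2) (g := fun=> 0)) => [|j]; last by case: (dmE i j).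
by rewrite diag_delta diag_0 addr0.
Qed.

Let dnV0 i : map_mx (dn i) (V0 x) = delta_mx i 0 *m row i (V2 x).
Proof.
rewrite dV0 // (row_ext (f := fun j => dn i (x j).1) (g := fun=> 0)) => [|j]; last by case: (dnE i j).
rewrite (row_ext (f := fun j => dn i (x j).2) (g := fun j => (i == j)%:R)) => [|j]; last by case: (dnE i j).
by rewrite diag_delta diag_0 add0r.
Qed.

Let dnV1 i : map_mx (dn i) (V1 x) = delta_mx i 0 *m row i (V12 x).
Proof.
rewrite derivation_eval_mx // => [|r m]; last by apply: mderiv_const => // m'; apply: coefP.
rewrite (row_ext (f := fun j => dn i (x j).1) (g := fun=> 0)) => [|j]; last by case: (dnE i j).
rewrite (row_ext (f := fun j => dn i (x j).2) (g := fun j => (i == j)%:R)) => [|j]; last by case: (dnE i j).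
rewrite diag_delta diag_0 add0r; congr (_ *m row i _).
by apply/matrixP => j r; rewrite !mxE mderiv_comm.
Qed.

Let dnV2 i : map_mx (dn i) (V2 x) = delta_mx i 0 *m row i (V22 x).
Proof.
rewrite derivation_eval_mx // => [|r m]; last by apply: mderiv_const => // m'; apply: coefP.
rewrite (row_ext (f := fun j => dn i (x j).1) (g := fun=> 0)) => [|j]; last by case: (dnE i j).
rewrite (row_ext (f := fun j => dn i (x j).2) (g := fun j => (i == j)%:R)) => [|j]; last by case: (dnE i j).
by rewrite diag_delta diag_0 add0r.
Qed.

Let daV0 i : map_mx (da i) (V0 x) = 0.
Proof.
rewrite dV0 // (row_ext (f := fun j => da i (x j).1) (g := fun=> 0)) => [|j]; last by case: (daE i j).
rewrite (row_ext (f := fun j => da i (x j).2) (g := fun=> 0)) => [|j]; last by case: (daE i j).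
by rewrite !diag_0 addr0.
Qed.

Let jet_free i : row_free (jet_mx D x i).
Proof. by rewrite row_free_unit unitmxE unitfE. Qed.

(** The rows of [W] are the first rows of the invertible jet matrix at [i]; the index provides such
    a matrix. *)
Let W_free (i : 'I_k) : row_free W.
Proof.
have /row_freeP[R hR] := jet_free i; apply/row_freeP.
exists (lsubmx R); move: hR; rewrite /jet_mx -{1}[R]hsubmxK mul_col_row.
by rewrite scalar_mx_block => /eq_block_mx[].
Qed.

Let V0W : (V0 x <= W)%MS.
Proof. by apply/submxP; exists (row_mx 1%:M 0); rewrite mul_row_col mul1mx mul0mx addr0. Qed.
Let V1W : (V1 x <= W)%MS.
Proof.
apply/submxP; exists (row_mx 0 (row_mx 1%:M 0)).
by rewrite !mul_row_col mul1mx !mul0mx add0r addr0.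
Qed.
Let V2W : (V2 x <= W)%MS.
Proof.
apply/submxP; exists (row_mx 0 (row_mx 0 1%:M)).
by rewrite !mul_row_col mul1mx !mul0mx !add0r.
Qed.

Variables (y : 'I_k -> K * K) (b : 'I_k -> K).
Hypothesis fiberE : \row_i a i *m V0 x = \row_i b i *m V0 y.

Let diagb := diag_mx (\row_i b i).
(** The tangent rows keep the weights [b], as they do in the derivative of [sum_j b_j v(y_j)]. Once
    [Y] is known to be free, no row of it is zero, which gives [b_j != 0]. *)
Let Y : 'M_(k + (k + k), jet_size k) :=
  col_mx (V0 y) (col_mx (diagb *m V1 y) (diagb *m V2 y)).

Let dq (d : K -> K) : derivation d -> (map_mx d (\row_i b i *m V0 y) <= Y)%MS.
Proof.
move=> hd; rewrite derivation_mulmx // dV0 // mulmxDr !mulmxA.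
have e (r : 'rV[K]_k) : \row_i b i *m diag_mx r = r *m diagb.
  by rewrite /diagb; apply/rowP => j; rewrite !mul_mx_diag !mxE mulrC.
rewrite !e -!mulmxA; apply/submxP.
exists (row_mx (map_mx d (\row_i b i)) (row_mx (\row_i d (y i).1) (\row_i d (y i).2))).
by rewrite !mul_row_col.
Qed.

Let map_row_delta (d : K -> K) (i : 'I_k) c :
  (forall j, d (a j) = c * (i == j)%:R) -> map_mx d (\row_j a j) = c *: delta_mx 0 i.
Proof. by move=> h; apply/rowP => j; rewrite !mxE h eqxx /= eq_sym. Qed.

(** Differentiating [sum_i a_i v(x_i)] along [a_i], [mu_i] and [nu_i] gives [v(x_i)],
    [a_i v_mu(x_i)] and [a_i v_nu(x_i)]. By [fiberE] these are also derivatives of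
    [sum_j b_j v(y_j)], which lie in the span of [Y]. *)
Let W_sub_Y : (W <= Y)%MS.
Proof.
rewrite /tangent_mx !col_mx_sub; apply/and3P; split; apply/row_subP => i.
- have := dq (hda i); rewrite -fiberE derivation_mulmx // daV0 mulmx0 addr0.
  rewrite (map_row_delta (i := i) (c := 1)) ?scale1r -?rowE // => j.
  by case: (daE i j) => _ _ ->; rewrite mul1r.
- have := dq (hdm i); rewrite -fiberE derivation_mulmx // dmV0.
  rewrite (map_row_delta (i := i) (c := 0)) => [|j]; last by case: (dmE i j) => _ _ ->; rewrite mul0r.
  rewrite scale0r mul0mx add0r mulmxA.
  have -> : \row_j a j *m delta_mx i 0 = (a i)%:M.
    by apply/rowP => j; rewrite !ord1 -colE !mxE.
  by rewrite mul_scalar_mx eqmx_scale.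
- have := dq (hdn i); rewrite -fiberE derivation_mulmx // dnV0.
  rewrite (map_row_delta (i := i) (c := 0)) => [|j]; last by case: (dnE i j) => _ _ ->; rewrite mul0r.
  rewrite scale0r mul0mx add0r mulmxA.
  have -> : \row_j a j *m delta_mx i 0 = (a i)%:M.
    by apply/rowP => j; rewrite !ord1 -colE !mxE.
  by rewrite mul_scalar_mx eqmx_scale.
Qed.

(** [Y] has as many rows as [W], whose rows are free and lie in the span of [Y]. *)
Let Y_free (i : 'I_k) : row_free Y.
Proof.
rewrite -row_leq_rank; have := W_free i; rewrite -row_leq_rank => h.
exact: leq_trans h (mxrankS W_sub_Y).
Qed.

Let Y_sub_W (i : 'I_k) : (Y <= W)%MS.
Proof.
have [_ <-] := mxrank_leqif_sup W_sub_Y.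
by have := W_free i; have := Y_free i; rewrite /row_free => /eqP -> /eqP ->.
Qed.

Let V0y_free (i : 'I_k) : row_free (V0 y).
Proof.
have /row_freeP[R hR] := Y_free i; apply/row_freeP.
exists (lsubmx R); move: hR; rewrite /Y -{1}[R]hsubmxK mul_col_row.
by rewrite scalar_mx_block => /eq_block_mx[].
Qed.

Let b0 i : b i != 0.
Proof.
apply/negP => /eqP bi.
pose z : 'rV[K]_(k + (k + k)) := row_mx 0 (row_mx (delta_mx 0 i) 0).
have zY : z *m Y = 0.
  rewrite /z /Y !mul_row_col !mul0mx add0r addr0 mulmxA -rowE.
  have -> : row i diagb = 0; last by rewrite mul0mx.
  by apply/rowP => j; rewrite !mxE; case: eqP => // <-; rewrite bi mul0rn.
have z0 : z = 0 by apply: (row_free_inj (Y_free i)); rewrite zY mul0mx.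
have /eqP := congr1 (fun M : 'rV_(k + (k + k)) => M 0 (rshift k (lshift k i))) z0.
by rewrite /z row_mxEr row_mxEl !mxE !eqxx oner_eq0.
Qed.

Let V0y_sub (i : 'I_k) : (V0 y <= W)%MS.
Proof. by have := Y_sub_W i; rewrite col_mx_sub => /andP[]. Qed.

Let undiag N (M : 'M[K]_(k, N)) : diag_mx (\row_i (b i)^-1) *m (diagb *m M) = M.
Proof.
by apply/matrixP => i r; rewrite !mul_diag_mx !mxE mulrA mulVf ?b0 // mul1r.
Qed.

Let V1y_sub (i : 'I_k) : (V1 y <= W)%MS.
Proof.
have := Y_sub_W i; rewrite !col_mx_sub => /and3P[_ h _].
by rewrite -[V1 y]undiag; apply: submx_trans h; apply: submxMl.
Qed.

Let V2y_sub (i : 'I_k) : (V2 y <= W)%MS.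
Proof.
have := Y_sub_W i; rewrite !col_mx_sub => /and3P[_ _ h].
by rewrite -[V2 y]undiag; apply: submx_trans h; apply: submxMl.
Qed.

Let dV0y_sub (i : 'I_k) (d : K -> K) : derivation d -> (map_mx d (V0 y) <= W)%MS.
Proof.
move=> hd; rewrite dV0 // addmx_sub //.
  exact: submx_trans (submxMl _ _) (V1y_sub i).
exact: submx_trans (submxMl _ _) (V2y_sub i).
Qed.

(* Differentiating [v(y) = A v(x) + B v1(x) + C v2(x)] along [nu_i] shows that
   [B v12(x_i) + C v22(x_i)] lies in [W]; these vectors are independent mod [W]. *)
Let V0y_span (i0 : 'I_k) : exists M : 'M[K]_k, V0 y = M *m V0 x.
Proof.
have /submxP[Z] := V0y_sub i0.
rewrite -[Z]hsubmxK -[rsubmx Z]hsubmxK /tangent_mx !mul_row_col.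
set M := lsubmx Z; set B := lsubmx (rsubmx Z); set C := rsubmx (rsubmx Z) => eV.
suff [B0 C0] : B = 0 /\ C = 0 by exists M; rewrite eV B0 C0 !mul0mx !addr0.
suff col0 i : col i B = 0 /\ col i C = 0.
  by split; apply/matrixP => j i; rewrite mxE;
    have [/matrixP/(_ j 0) + /matrixP/(_ j 0)] := col0 i; rewrite !mxE.
have sub : ((col i B *m row i (V12 x) + col i C *m row i (V22 x))%R <= W)%MS.
  have := dV0y_sub i (hdn i); rewrite eV !(derivation_map_mxD (hdn i)).
  rewrite !(derivation_mulmx (hdn i)) dnV0 dnV1 dnV2 => h.
  have mW (Q : 'M_k) (V : 'M_(k, jet_size k)) : (V <= W)%MS -> (Q *m V <= W)%MS.
    by apply: submx_trans; apply: submxMl.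
  have rW (Q : 'cV_k) (V : 'M_(k, jet_size k)) : (V <= W)%MS -> (Q *m row i V <= W)%MS.
    move=> hV; apply: submx_trans (submxMl _ _) _.
    exact: submx_trans (row_sub _ _) hV.
  have e V : B *m (delta_mx i 0 *m row i V) = col i B *m row i V.
    by rewrite mulmxA -colE.
  have e' V : C *m (delta_mx i 0 *m row i V) = col i C *m row i V.
    by rewrite mulmxA -colE.
  move: h; rewrite e e' mulmxA.
  set T1 := _ *m V0 x + _; set T2 := _ *m V1 x; set T3 := _ *m V2 x.
  set S1 := col i B *m _; set S2 := col i C *m _ => h.
  have acD (A : zmodType) (t1 t2 t3 s1 s2 : A) :
      s1 + s2 = t1 + (t2 + s1 + (t3 + s2)) - (t1 + (t2 + t3)).
    by rewrite (addrACA t2) (addrA t1) [t1 + _ + _]addrC addrK.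
  rewrite (acD _ T1 T2 T3).
  rewrite addmx_sub // eqmx_opp !addmx_sub ?mW // rW //.
have /submxP[Q eQ] := sub.
(* These are the coefficients of a vanishing combination of the rows of the jet matrix at [i], which
   is invertible. *)
pose z := row_mx (- Q) (row_mx (col i B) (col i C)).
have z0 : z = 0.
  apply: (row_free_inj (jet_free i)); rewrite mul0mx /z /jet_mx !mul_row_col eQ.
  by rewrite mulNmx addNr.
move: z0; rewrite /z -[X in _ = X]row_mx0 => /eq_row_mx[_].
by rewrite -row_mx0 => /eq_row_mx.
Qed.

(** Row [j] of [V0 y = M *m V0 x], differentiated along one parameter of [x_i], expresses
    [M j i *: v] through the two tangent vectors at [y_j] and the rows of [V0 x]. *)
Let row_span (M : 'M[K]_k) (d : K -> K) (i j : 'I_k) (v : 'rV_(jet_size k)) :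
  V0 y = M *m V0 x -> derivation d -> map_mx d (V0 x) = delta_mx i 0 *m v ->
  M j i != 0 -> (v <= col_mx (row j (V1 y)) (row j (V2 y)) + V0 x)%MS.
Proof.
move=> eV hd dVx Mji; have := dV0 y hd.
rewrite {1}eV (derivation_mulmx hd) dVx mulmxA -colE.
move=> /(congr1 (row j)); rewrite !linearD /= !row_mul !row_diag_mx -!scalemxAl -!rowE.
have -> : row j (col i M) = (M j i)%:M by apply/rowP => l; rewrite ord1 !mxE.
rewrite mul_scalar_mx; set c1 := (\row_i d (y i).1) 0 j; set c2 := (\row_i d (y i).2) 0 j.
set r1 := row j (V1 y); set r2 := row j (V2 y) => e.
have /andP[r1T r2T] : (r1 <= col_mx r1 r2)%MS && (r2 <= col_mx r1 r2)%MS.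
  by rewrite -col_mx_sub.
rewrite -(eqmx_scale v Mji).
have -> : M j i *: v = c1 *: r1 + c2 *: r2 - row j (map_mx d M) *m V0 x.
  by rewrite -e addrAC subrr add0r.
rewrite addmx_sub ?eqmx_opp //; last exact: submx_trans (submxMl _ _) (addsmxSr _ _).
by apply: submx_trans (addsmxSl _ _); rewrite addmx_sub // scalemx_sub.
Qed.

(** If [i] and [l] were distinct, then [v_mu(x_i)], [v_nu(x_i)] and [v_mu(x_l)], which are
    independent modulo [V0 x], would by [row_span] lie in a space spanned modulo [V0 x] by two
    vectors. The map [f] selects these three rows of [W]. *)
Let single_support (M : 'M[K]_k) (i j l : 'I_k) :
  V0 y = M *m V0 x -> M j i != 0 -> M j l != 0 -> i = l.
Proof.
move=> eV ji jl; apply/eqP/negPn/negP => il.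
set T := col_mx (row j (V1 y)) (row j (V2 y)).
pose f (c : 'I_3) : 'I_(k + (k + k)) :=
  tnth [tuple rshift k (lshift k i); rshift k (rshift k i); rshift k (lshift k l)] c.
have f_inj : injective f.
  move=> c c' /eqP.
  case: c => [[|[|[|//]]] hc]; case: c' => [[|[|[|//]]] hc'];
    rewrite /f !(tnth_nth (lshift _ i)) /= => h; apply/val_inj => //=; move: h;
    rewrite -!val_eqE /= ?eqn_add2l; have := ltn_ord i; have := ltn_ord l;
    move: il; rewrite -val_eqE /=; by lia.
have rowW (v : 'M_(k, jet_size k)) d m : derivation d -> map_mx d (V0 x) = delta_mx m 0 *m row m v ->
    M j m != 0 -> (row m v <= T + V0 x)%MS.
  by move=> hd dv Mjm; apply: row_span eV hd dv Mjm.
have sub : (rowsub f W <= T + V0 x)%MS.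
  apply/row_subP => c; rewrite row_rowsub.
  case: c => [[|[|[|//]]] hc]; rewrite /f (tnth_nth (lshift _ i)) /= /tangent_mx.
  - by rewrite rowKd rowKu; apply: rowW (hdm i) (dmV0 i) ji.
  - by rewrite !rowKd; apply: rowW (hdn i) (dnV0 i) ji.
  - by rewrite rowKd rowKu; apply: rowW (hdm l) (dmV0 l) jl.
have [u eS] := sub_addsmxP sub.
have /row_freeP[R hR] := W_free i.
(* The columns [f] of a right inverse of [W] kill [V0 x] and send the three rows to the identity
   matrix, which would then factor through the two rows of [T]. *)
have R3 : rowsub f W *m colsub f R = 1%:M.
  apply/matrixP => c c'; have := congr1 (fun Q : 'M_(k + (k + k)) => Q (f c) (f c')) hR.
  rewrite !mxE (inj_eq f_inj) => <-.
  by apply: eq_bigr => r _; rewrite !mxE.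
have VR : V0 x *m colsub f R = 0.
  apply/matrixP => r c; have e0 : (lshift (k + k) r == f c) = false.
    by case: c => [[|[|[|//]]] hc]; rewrite /f (tnth_nth (lshift _ i)) /= eq_lrshift.
  have e : (W *m R) (lshift _ r) (f c) = 0 by rewrite hR mxE e0.
  rewrite [RHS]mxE -[RHS]e [LHS]mxE [RHS]mxE.
  by apply: eq_bigr => m _; rewrite [W _ _]col_mxEu [colsub f R m c]mxE.
have := congr1 (fun Q => \rank (Q *m colsub f R)) eS.
rewrite R3 mulmxDl -!mulmxA VR mulmx0 addr0 mxrank1 => e.
have := leq_trans (mxrankM_maxr u.1 (T *m colsub f R)) (rank_leq_row _).
by rewrite -e.
Qed.

Theorem generic_identifiability :
  exists s : 'S_k, forall j, y j = x (s j) /\ b j = a (s j).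
Proof.
have [M eV] : exists M : 'M[K]_k, V0 y = M *m V0 x.
  case: (posnP k) => [k0|kpos]; last exact: V0y_span (Ordinal kpos).
  by exists 0; apply/matrixP => i; have := ltn_ord i; rewrite {2}k0.
have rE j i r : (forall l, M j l != 0 -> i = l) -> V0 y j r = M j i * V0 x i r.
  move=> h; rewrite eV mxE (bigD1 i) //= big1 ?addr0 // => l li.
  by apply/eqP; rewrite mulf_eq0; apply/orP; left; apply: contraNT li => /h ->.
have lt0 j : (j < k -> 0 < jet_size k)%N by rewrite !addnS.
have ex j : exists i, M j i != 0.
  apply/existsP; apply: contraT; rewrite negb_exists => /forallP h.
  have := congr1 (fun Q : 'M_(k, jet_size k) => Q j (Ordinal (lt0 _ (ltn_ord j)))) eV.
  rewrite !mxE /= moment_mpoly0 meval1 big1 => [|i _]; first by move/eqP; rewrite oner_eq0.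
  by have := h i; rewrite negbK => /eqP ->; rewrite mul0r.
have [s hs] : exists s : 'I_k -> 'I_k, forall j, M j (s j) != 0.
  by exists (fun j => xchoose (ex j)) => j; apply: (xchooseP (ex j)).
have uniqM j l : M j l != 0 -> s j = l by apply: single_support eV (hs j).
have lt1 (j : 'I_k) : (1 < jet_size k)%N by rewrite !addnS.
have lt2 (j : 'I_k) : (2 < jet_size k)%N.
  by have := ltn_ord j; lia.
(* The zeroth moment is [1] at every point. *)
have Ms j : M j (s j) = 1.
  have := rE j (s j) (Ordinal (lt0 _ (ltn_ord j))) (uniqM j).
  by rewrite !mxE /= moment_mpoly0 !meval1 mulr1.
(* The next two moments are [mu] and [mu (mu + nu)]; they determine [nu] because [mu] is nonzero at
   [x]. *)
have ys j : y j = x (s j).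
  have := rE j (s j) (Ordinal (lt1 j)) (uniqM j).
  rewrite !mxE Ms mul1r /= moment_mpoly1 !mevalXU /pair_fun /= => e1.
  have := rE j (s j) (Ordinal (lt2 j)) (uniqM j).
  rewrite !mxE Ms mul1r /= moment_mpoly2 !mevalM !mevalD !mevalXU /pair_fun /= e1.
  move/(mulfI (x0 _))/addrI => e2.
  by rewrite [y j]surjective_pairing e1 e2 -surjective_pairing.
(* A repeated value of [s] would give two equal rows of [V0 y], whose rows are free. *)
have s_inj : injective s.
  move=> j j' e; apply/eqP; apply: contraT => jj'.
  have : delta_mx 0 j = delta_mx 0 j' :> 'rV[K]_k.
    apply: (row_free_inj (V0y_free j)); rewrite -!rowE.
    by apply/rowP => r; rewrite !mxE !ys e.
  move/rowP/(_ j)/eqP; rewrite !mxE !eqxx eq_sym /= eq_sym (negPf jj') oner_eq0.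
  by [].
pose p := perm s_inj; exists p => j; split; first by rewrite permE.
have eVp : V0 y = perm_mx p *m V0 x.
  by rewrite -row_permE; apply/matrixP => i r; rewrite !mxE ys permE.
have V0x_free : row_free (V0 x).
  have /row_freeP[R hR] := W_free j; apply/row_freeP.
  exists (lsubmx R); move: hR; rewrite -{1}[R]hsubmxK mul_col_row.
  by rewrite scalar_mx_block => /eq_block_mx[].
have : \row_i a i = \row_i b i *m perm_mx p.
  by apply: (row_free_inj V0x_free); rewrite fiberE eVp mulmxA.
rewrite -[p in perm_mx p]invgK -col_permE => /rowP/(_ (p j)).
by rewrite !mxE permK.
Qed.

End GenericIdentifiability.

(** * The parameter space and a generic point of it *)

Section ParameterSpace.
Variables (K : fieldType) (D : distribution) (k : nat).

(* One variable for each of the two parameters and for the weight of each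
   component. *)
Definition nvars := #|{: 'I_k * 'I_3}|.
Definition var (i : 'I_k) (c : 'I_3) : 'I_nvars := enum_rank (i, c).

Definition param_point (p : 'I_nvars -> K) (i : 'I_k) : K * K := (p (var i 0), p (var i 1)).
Definition param_weight (p : 'I_nvars -> K) (i : 'I_k) : K := p (var i 2%:R).

Definition param_of (x : 'I_k -> K * K) (a : 'I_k -> K) (v : 'I_nvars) : K :=
  let: (i, c) := enum_val v in if c == 0 then (x i).1 else if c == 1 then (x i).2 else a i.

Lemma param_pointK x a i : param_point (param_of x a) i = x i.
Proof. by rewrite /param_point /param_of !enum_rankK /= -surjective_pairing. Qed.

Lemma param_weightK x a i : param_weight (param_of x a) i = a i.
Proof. by rewrite /param_weight /param_of !enum_rankK. Qed.

Definition subst_point (i : 'I_k) : 2.-tuple {mpoly K[nvars]} :=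
  [tuple 'X_(var i 0); 'X_(var i 1)].

Lemma subst_pointE (Q : {mpoly K[2]}) i p :
  (Q \mPo subst_point i).@[p] = Q.@[pair_fun (param_point p i)].
Proof.
rewrite comp_mpoly_meval; apply: meval_eq => -[[|[|//]] h];
  by rewrite (tnth_nth 0) /= mevalXU.
Qed.

(* The cone version of the mixture moment map, with unnormalised weights. *)
Definition mixture_mpoly (r : nat) : {mpoly K[nvars]} :=
  \sum_i 'X_(var i 2%:R) * (moment_mpoly K D r \mPo subst_point i).

Lemma mixture_mpolyE r p :
  (mixture_mpoly r).@[p] = \sum_i param_weight p i *
    (moment_mpoly K D r).@[pair_fun (param_point p i)].
Proof.
rewrite /mixture_mpoly raddf_sum /=; apply: eq_bigr => i _.
by rewrite mevalM mevalXU subst_pointE.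
Qed.

(** The determinant of the jet matrix as a polynomial in all parameters, so that its nonvanishing
    can be required of a generic point. *)
Definition jet_mpoly (i : 'I_k) : {mpoly K[nvars]} :=
  let pm (Q : nat -> {mpoly K[2]}) : 'M_(k, jet_size k) :=
    \matrix_(i, r) (Q r \mPo subst_point i) in
  let P := moment_mpoly K D in
  \det (col_mx
    (col_mx (pm P) (col_mx (pm (fun r => (P r)^`M(0))) (pm (fun r => (P r)^`M(1)))))
    (col_mx (row i (pm (fun r => (P r)^`M(1)^`M(0))))
            (row i (pm (fun r => (P r)^`M(1)^`M(1)))))).

End ParameterSpace.

Lemma jet_mpolyE (K : numFieldType) D k i (p : 'I_(nvars k) -> K) :
  (jet_mpoly K D i).@[p] = \det (jet_mx D (param_point p) i).
Proof.
rewrite /jet_mpoly -det_map_mx !map_col_mx !map_row.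
have e (Q : nat -> {mpoly K[2]}) :
    map_mx (meval p) (\matrix_(i < k, r < jet_size k) (Q r \mPo subst_point K i)) =
    eval_mx (jet_size k) Q (param_point p).
  by apply/matrixP => j r; rewrite !mxE subst_pointE.
pose P := moment_mpoly K D.
by rewrite (e P) (e (fun r => (P r)^`M(0))) (e (fun r => (P r)^`M(1)))
  (e (fun r => (P r)^`M(1)^`M(0))) (e (fun r => (P r)^`M(1)^`M(1))).
Qed.

(** The point has dual derivations that kill the coefficients of every polynomial to be avoided, so
    [generic_identifiability] applies. [Omega] is a further polynomial that the caller wants to be
    nonzero. *)
Lemma generic_parameter (K : numClosedFieldType) (D : distribution) k
    (Omega : {mpoly K[nvars k]}) :
  (forall f : nat -> K, exists a, forall n, f n <> a) -> (0 < k)%N -> Omega != 0 ->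
  exists p : 'I_(nvars k) -> K,
  let x := param_point p in let a := param_weight p in
  [/\ Omega.@[p] != 0, forall i, (x i).1 != 0, forall i, (x i).2 != 0,
    \sum_i a i != 0 &
    forall (y : 'I_k -> K * K) (b : 'I_k -> K),
    (forall r, (r < 3 * k + 3)%N ->
       \sum_i a i * (moment_mpoly K D r).@[pair_fun (x i)] =
       \sum_i b i * (moment_mpoly K D r).@[pair_fun (y i)]) ->
    exists s : 'S_k, forall j, y j = x (s j) /\ b j = a (s j)].
Proof.
move=> uncK kpos O0.
pose S : {mpoly K[nvars k]} := \sum_i 'X_(var i 2%:R).
(* All open conditions in one polynomial: the given one, nonzero coordinates, nonzero total weight
   and invertible jet matrices. *)
pose Om := Omega * (\prod_(v : 'I_(nvars k)) 'X_v) * S * \prod_i jet_mpoly K D i.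
have Om0 : Om != 0.
  rewrite !mulf_neq0 //.
  - by apply/prodf_neq0 => v _; rewrite -msize_poly_eq0 msizeX.
  - apply/negP => /eqP S0; have := congr1 (meval (fun=> 1)) S0.
    rewrite /S raddf_sum /= meval0.
    rewrite (eq_bigr (fun=> 1)) => [|i _]; last by rewrite mevalXU.
    by rewrite sumr_const card_ord => /eqP; rewrite pnatr_eq0 (gtn_eqF kpos).
  - apply/prodf_neq0 => i _; have [x hx] := @jet_mx_unit_exists K D k.
    apply/negP => /eqP J0; have := jet_mpolyE D i (param_of x (fun=> 0)).
    rewrite J0 meval0 => /esym/eqP.
    have -> : param_point (param_of x (fun=> 0)) = x by apply/funext => j; apply: param_pointK.
    by rewrite (negPf (hx i)).
have [p [d [hd dp dS]]] := generic_point uncK [seq Om@_m | m <- msupp Om] (nvars k).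
have : Om.@[p] != 0.
  apply: (generic_meval_neq0 hd dp) => // i m.
  have [mO|] := boolP (m \in msupp Om); first by apply: dS; apply/mapP; exists m.
  by move/memN_msupp_eq0 ->; apply: derivation0.
rewrite /Om !mevalM !mulf_eq0 !negb_or -!andbA => /and4P[Op Xp Sp Jp].
have p0 v : p v != 0.
  move: Xp; rewrite (big_morph _ (mevalM p) (meval1 p)) => /prodf_neq0/(_ v isT).
  by rewrite mevalXU.
exists p; split=> /= [//|i|i||y b e]; rewrite ?p0 //.
- by move: Sp; rewrite /S raddf_sum /=; under eq_bigr do rewrite mevalXU.
have varE i j c c' : (var i c == var j c') = (i == j) && (c == c').
  by rewrite /var (inj_eq enum_rank_inj).
apply: (@generic_identifiability K D k (param_point p) (param_weight p) (fun i => d (var i 0)) (fun i => d (var i 1))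
  (fun i => d (var i 2%:R))) => //.
- by move=> i j; rewrite !dp !varE !andbT !andbF.
- by move=> i j; rewrite !dp !varE !andbT !andbF.
- by move=> i j; rewrite !dp !varE !andbT !andbF.
- move=> i; rewrite -jet_mpolyE.
  by move: Jp; rewrite (big_morph _ (mevalM p) (meval1 p)) => /prodf_neq0/(_ i isT).
1,2: by move=> i; apply: p0.
apply/rowP => r; have := e r; rewrite !mxE.
have -> : (r < 3 * k + 3)%N by have := ltn_ord r; lia.
move=> /(_ isT) h; under [LHS]eq_bigr do rewrite !mxE.
by under [RHS]eq_bigr do rewrite !mxE.
Qed.

(** * Quantifier elimination *)

Section Definability.
Variable F : closedFieldType.
Implicit Types (P : (nat -> F) -> Prop) (T : (nat -> F) -> F) (rho : nat -> F).

(** A finite environment is read as a function on all indices, with default value [0] past its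
    end. *)
Definition definable P : Prop :=
  exists2 f : GRing.formula F, GRing.rformula f
    & forall e, GRing.holds e f <-> P (nth 0 e).

Definition definable_term T : Prop :=
  exists2 t : GRing.term F, GRing.rterm t & forall e, GRing.eval e t = T (nth 0 e).

Lemma definable_ext P1 P2 : (forall rho, P1 rho <-> P2 rho) -> definable P1 -> definable P2.
Proof. by move=> h [f rf hf]; exists f => // e; rewrite -h. Qed.

Lemma definable_eq T1 T2 : definable_term T1 -> definable_term T2 ->
  definable (fun rho => T1 rho = T2 rho).
Proof.
move=> [t1 r1 h1] [t2 r2 h2]; exists (GRing.Equal t1 t2); first by rewrite /= r1.
by move=> e /=; rewrite h1 h2.
Qed.

Lemma definable_and P1 P2 : definable P1 -> definable P2 ->
  definable (fun rho => P1 rho /\ P2 rho).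
Proof.
move=> [f1 r1 h1] [f2 r2 h2]; exists (GRing.And f1 f2); first by rewrite /= r1.
by move=> e /=; rewrite h1 h2.
Qed.

Lemma definable_imp P1 P2 : definable P1 -> definable P2 ->
  definable (fun rho => P1 rho -> P2 rho).
Proof.
move=> [f1 r1 h1] [f2 r2 h2]; exists (GRing.Implies f1 f2); first by rewrite /= r1.
by move=> e /=; rewrite h1 h2.
Qed.

Lemma definable_not P : definable P -> definable (fun rho => ~ P rho).
Proof.
by move=> [f r h]; exists (GRing.Not f) => // e /=; rewrite h.
Qed.

Lemma definable_forall_fin (I : finType) (P : I -> (nat -> F) -> Prop) :
  (forall i, definable (P i)) -> definable (fun rho => forall i, P i rho).
Proof.
move=> dP; suff : definable (fun rho => {in enum I, forall i, P i rho}).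
  by apply: definable_ext => rho; split=> h i => [|_]; apply: h; rewrite ?mem_enum.
elim: (enum I) => [|i s IH]; first by exists (GRing.Bool true) => // e; split.
apply: definable_ext (definable_and (dP i) IH) => rho; split=> [[h1 h2] j|h].
  by rewrite inE => /orP[/eqP -> //|]; apply: h2.
by split=> [|j js]; apply: h; rewrite inE ?eqxx ?js ?orbT.
Qed.

Lemma definable_exists_fin (I : finType) (P : I -> (nat -> F) -> Prop) :
  (forall i, definable (P i)) -> definable (fun rho => exists i, P i rho).
Proof.
move=> dP; have := definable_not (definable_forall_fin (fun i => definable_not (dP i))).
apply: definable_ext => rho; split=> [h|[i h1] h2]; last exact: h2 h1.
by apply: contrapT => nh; apply: h => i Pi; apply: nh; exists i.
Qed.

Lemma definable_term_mpoly n (Q : {mpoly F[n]}) (v : 'I_n -> nat) :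
  definable_term (fun rho => Q.@[fun i => rho (v i)]).
Proof.
have dX m : definable_term (fun rho => \prod_(i < n) rho (v i) ^+ m i).
  elim: (index_enum _) => [|i s [t rt ht]].
    by exists (GRing.NatConst F 1) => // e; rewrite big_nil.
  exists (GRing.Mul (GRing.Exp (GRing.Var F (v i)) (m i)) t) => // e.
  by rewrite /= ht big_cons.
suff : definable_term (fun rho => \sum_(m <- msupp Q) Q@_m * \prod_(i < n) rho (v i) ^+ m i).
  by move=> [t rt ht]; exists t => // e; rewrite ht mevalE.
elim: (msupp Q) => [|m s [t rt ht]].
  by exists (GRing.NatConst F 0) => // e; rewrite big_nil.
have [u ru hu] := dX m.
exists (GRing.Add (GRing.Mul (GRing.Const Q@_m) u) t); first by rewrite /= ru.
by move=> e; rewrite /= ht hu big_cons.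
Qed.

Lemma definable_term_var i : definable_term (fun rho => rho i).
Proof. by exists (GRing.Var F i). Qed.

Lemma definable_term_const c : definable_term (fun=> c).
Proof. by exists (GRing.Const c). Qed.

(** Overwrites the variables [m, ..., m + n - 1], so that a whole tuple can be quantified at
    once. *)
Definition set_block (m n : nat) (u : 'I_n -> F) rho : nat -> F := fun i =>
  if (i < m)%N then rho i else if insub (i - m)%N is Some j then u j else rho i.

Lemma set_block_lt m n (u : 'I_n -> F) rho i : (i < m)%N -> set_block m u rho i = rho i.
Proof. by rewrite /set_block => ->. Qed.

Lemma set_block_add m n (u : 'I_n -> F) rho (j : 'I_n) : set_block m u rho (m + j)%N = u j.
Proof. by rewrite /set_block ltnNge leq_addr /= addnC addnK valK. Qed.

Lemma definable_exists_block m n P : definable P ->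
  definable (fun rho => exists u : 'I_n -> F, P (set_block m u rho)).
Proof.
move=> [f rf hf]; exists (foldr GRing.Exists f (iota m n)).
  by elim: (iota m n).
move=> e; rewrite -GRing.foldExistsP; split=> [[e' ee' /hf Pe']|[u Pu]].
  exists (fun j : 'I_n => nth 0 e' (m + j)).
  suff -> : set_block m (fun j : 'I_n => nth 0 e' (m + j)) (nth 0 e) = nth 0 e' by [].
  apply/funext => i; rewrite /set_block; case: ltnP => im.
    by apply: ee'; rewrite !inE mem_iota negb_and -ltnNge im.
  case: insubP => [j _ ji|]; first by rewrite ji subnKC.
  rewrite -leqNgt => le; apply: ee'; rewrite !inE mem_iota negb_and -leqNgt.
  by rewrite -leq_subRL // le orbT.
(* A list of this length holds both the old environment and the new block. *)
pose N := maxn (size e) (m + n).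
have E : nth 0 (mkseq (set_block m u (nth 0 e)) N) = set_block m u (nth 0 e).
  apply/funext => i; have [lt|le] := ltnP i N; first by rewrite nth_mkseq.
  move: le; rewrite /N geq_max => /andP[le1 le2].
  rewrite nth_default ?size_mkseq ?geq_max ?le1 //.
  rewrite /set_block ltnNge (leq_trans (leq_addr _ _) le2) /=.
  by rewrite insubN ?nth_default // -leqNgt leq_subRL // (leq_trans (leq_addr _ _) le2).
exists (mkseq (set_block m u (nth 0 e)) N); last by apply/hf; rewrite E.
move=> i; rewrite !inE mem_iota => ni; rewrite E /set_block.
case: ltnP => // im; rewrite insubN //; move: ni; rewrite im /= -leqNgt -leqNgt.
by rewrite leq_subRL.
Qed.

Lemma definable_forall_block m n P : definable P ->
  definable (fun rho => forall u : 'I_n -> F, P (set_block m u rho)).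
Proof.
move=> dP; have := definable_not (definable_exists_block m n (definable_not dP)).
apply: definable_ext => rho; split=> [h u|h [u nP]]; last exact: nP (h u).
by apply: contrapT => nP; apply: h; exists u.
Qed.

Definition env_of m (w : 'I_m -> F) : nat -> F :=
  fun i => if insub i is Some j then w j else 0.

Lemma env_of_nth m (w : 'I_m -> F) : nth 0 (mkseq (env_of w) m) = env_of w.
Proof.
apply/funext => i; have [lt|le] := ltnP i m; first by rewrite nth_mkseq.
by rewrite nth_default ?size_mkseq // /env_of insubN // -leqNgt.
Qed.

Lemma env_of_ord m (w : 'I_m -> F) (i : 'I_m) : env_of w i = w i.
Proof. by rewrite /env_of valK. Qed.

Lemma rterm_mpoly m (t : GRing.term F) : GRing.rterm t ->
  exists Q : {mpoly F[m]}, forall w, GRing.eval (mkseq (env_of w) m) t = Q.@[w].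
Proof.
elim: t => //=.
- move=> i _; case: (ltnP i m) => im.
    exists 'X_(Ordinal im) => w; rewrite mevalXU env_of_nth.
    exact: (env_of_ord w (Ordinal im)).
  exists 0 => w; rewrite meval0 nth_default // size_mkseq //.
- by move=> c _; exists c%:MP => w; rewrite mevalC.
- by move=> c _; exists c%:R => w; rewrite -mpolyC_nat mevalC.
- move=> t1 IH1 t2 IH2 /andP[/IH1[Q1 h1] /IH2[Q2 h2]].
  by exists (Q1 + Q2) => w; rewrite mevalD h1 h2.
- by move=> t1 IH1 /IH1[Q1 h1]; exists (- Q1) => w; rewrite mevalN h1.
- by move=> t1 IH1 c /IH1[Q1 h1]; exists (Q1 *+ c) => w; rewrite mevalMn h1.
- move=> t1 IH1 t2 IH2 /andP[/IH1[Q1 h1] /IH2[Q2 h2]].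
  by exists (Q1 * Q2) => w; rewrite mevalM h1 h2.
- by move=> t1 IH1 c /IH1[Q1 h1]; exists (Q1 ^+ c) => w; rewrite rmorphXn /= h1.
Qed.

(* Chevalley's theorem, through quantifier elimination. *)
Lemma definable_atoms m P : definable P ->
  exists gs : seq {mpoly F[m]}, forall w w' : 'I_m -> F,
    {in gs, forall g, (g.@[w] == 0) = (g.@[w'] == 0)} -> P (env_of w) -> P (env_of w').
Proof.
move=> [f0 rf0 hf0].
pose f := GRing.quantifier_elim (@ClosedFieldQE.ex_elim F) f0.
have qfP e := GRing.quantifier_elim_rformP (@ClosedFieldQE.wf_ex_elim F)
  (ClosedFieldQE.holds_ex_elim (@solve_monicpoly F)) e rf0.
have : GRing.qf_form f && GRing.rformula f.
  exact: (GRing.quantifier_elim_wf (@ClosedFieldQE.wf_ex_elim F)).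
move=> /andP[qf rf].
(* For the quantifier-free [f], take as [gs] the differences of the two sides of its atomic
   equations. *)
suff [gs hgs] : exists gs : seq {mpoly F[m]}, forall w w' : 'I_m -> F,
    {in gs, forall g, (g.@[w] == 0) = (g.@[w'] == 0)} ->
    GRing.qf_eval (mkseq (env_of w) m) f = GRing.qf_eval (mkseq (env_of w') m) f.
  exists gs => w w' /hgs e; rewrite -(env_of_nth w) -(env_of_nth w') -!hf0.
  by move/qfP; rewrite -/f e => /qfP.
elim: f qf rf {qfP} => //=.
- by move=> b _ _; exists [::].
- move=> t1 t2 _ /andP[/(rterm_mpoly m)[Q1 h1] /(rterm_mpoly m)[Q2 h2]].
  exists [:: Q1 - Q2] => w w' /(_ _ (mem_head _ _)).
  by rewrite !mevalB !subr_eq0 !h1 !h2.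
- move=> f1 IH1 f2 IH2 /andP[q1 q2] /andP[r1 r2].
  have [[g1 h1] [g2 h2]] := (IH1 q1 r1, IH2 q2 r2).
  exists (g1 ++ g2) => w w' h; rewrite (h1 w w') ?(h2 w w') // => g gg; apply: h;
    by rewrite mem_cat gg ?orbT.
- move=> f1 IH1 f2 IH2 /andP[q1 q2] /andP[r1 r2].
  have [[g1 h1] [g2 h2]] := (IH1 q1 r1, IH2 q2 r2).
  exists (g1 ++ g2) => w w' h; rewrite (h1 w w') ?(h2 w w') // => g gg; apply: h;
    by rewrite mem_cat gg ?orbT.
- move=> f1 IH1 f2 IH2 /andP[q1 q2] /andP[r1 r2].
  have [[g1 h1] [g2 h2]] := (IH1 q1 r1, IH2 q2 r2).
  exists (g1 ++ g2) => w w' h; rewrite (h1 w w') ?(h2 w w') // => g gg; apply: h;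
    by rewrite mem_cat gg ?orbT.
- move=> f1 IH1 q1 r1; have [g1 h1] := IH1 q1 r1.
  by exists g1 => w w' h; rewrite (h1 w w').
Qed.

(** Quantification over tuples of fixed length and a choice of relabelling; for a finite type [S]
    this is a first-order condition on [w]. [Q] keeps [u] where the change of parameters can be
    inverted. *)
Definition unique_fiber m n (Phi : 'I_m -> {mpoly F[n]}) (Q : {mpoly F[n]})
    (S : Type) (act : S -> 'I_n -> 'I_n) (w : 'I_m -> F) : Prop :=
  exists u : 'I_n -> F, [/\ Q.@[u] <> 0, forall r, w r = (Phi r).@[u] &
    forall u' : 'I_n -> F, (forall r, w r = (Phi r).@[u']) ->
      exists s, forall v, u' v = u (act s v)].

Lemma unique_fiber_atoms m n (Phi : 'I_m -> {mpoly F[n]}) (Q : {mpoly F[n]})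
    (S : finType) (act : S -> 'I_n -> 'I_n) :
  exists gs : seq {mpoly F[m]}, forall w w' : 'I_m -> F,
    {in gs, forall g, (g.@[w] == 0) = (g.@[w'] == 0)} ->
    unique_fiber Phi Q act w -> unique_fiber Phi Q act w'.
Proof.
(* Layout of the variables: [w] comes first, then [u], then [u']. *)
pose ux (v : 'I_n) := (m + v)%N; pose uy (v : 'I_n) := (m + n + v)%N.
pose P2 rho := (forall r : 'I_m, rho r = (Phi r).@[fun v => rho (uy v)]) ->
  exists s : S, forall v, rho (uy v) = rho (ux (act s v)).
pose P1 rho := Q.@[fun v => rho (ux v)] <> 0 /\
  ((forall r : 'I_m, rho r = (Phi r).@[fun v => rho (ux v)]) /\
   forall u' : 'I_n -> F, P2 (set_block (m + n) u' rho)).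
pose P0 rho := exists u : 'I_n -> F, P1 (set_block m u rho).
have d0 : definable P0.
  apply: definable_exists_block; apply: definable_and.
    apply/definable_not/definable_eq; first exact: definable_term_mpoly.
    exact: definable_term_const.
  apply: definable_and.
    apply: definable_forall_fin => r; apply: definable_eq; first exact: definable_term_var.
    exact: definable_term_mpoly.
  apply: definable_forall_block; apply: definable_imp.
    apply: definable_forall_fin => r; apply: definable_eq; first exact: definable_term_var.
    exact: definable_term_mpoly.
  apply: definable_exists_fin => s; apply: definable_forall_fin => v.
  by apply: definable_eq; apply: definable_term_var.
have P0E w : P0 (env_of w) <-> unique_fiber Phi Q act w.
  have e1 u : (fun v => set_block m u (env_of w) (ux v)) = u :> ('I_n -> F).
    by apply/funext => v; rewrite set_block_add.
  have e2 (u : 'I_n -> F) (r : 'I_m) : set_block m u (env_of w) r = w r.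
    by rewrite set_block_lt ?env_of_ord.
  have e3 (u u' : 'I_n -> F) : (fun v => set_block (m + n) u' (set_block m u (env_of w)) (uy v)) = u'.
    by apply/funext => v; rewrite set_block_add.
  have e4 (u u' : 'I_n -> F) v : set_block (m + n) u' (set_block m u (env_of w)) (ux v) = u v.
    by rewrite set_block_lt ?set_block_add // ltn_add2l.
  have e5 (u u' : 'I_n -> F) (r : 'I_m) : set_block (m + n) u' (set_block m u (env_of w)) r = w r.
    by rewrite set_block_lt ?e2 // (leq_trans (ltn_ord r)) // leq_addr.
  have P1E u : P1 (set_block m u (env_of w)) <-> [/\ Q.@[u] <> 0, forall r, w r = (Phi r).@[u] &
    forall u' : 'I_n -> F, (forall r, w r = (Phi r).@[u']) ->
      exists s, forall v, u' v = u (act s v)].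
    rewrite /P1 /P2 e1; split=> [[h1 [h2 h3]]|[h1 h2 h3]].
      split=> // [r|u' hu']; first by rewrite -h2 e2.
      have [|s hs] := h3 u'; first by move=> r; rewrite e3 e5.
      by exists s => v; have := hs v; rewrite e4 set_block_add.
    split=> //; split=> [r|u' hu']; first by rewrite e2.
    have [|s hs] := h3 u'; first by move=> r; have := hu' r; rewrite e3 e5.
    by exists s => v; rewrite e4 set_block_add.
  by split=> -[u hu]; exists u; apply/P1E.
have [gs hgs] := definable_atoms m d0.
by exists gs => w w' /hgs h /P0E /h /P0E.
Qed.

End Definability.

(** * The ideal of the secant variety *)

Lemma dhomog_meval (K : fieldType) n (f : {mpoly K[n]}) e (c : K) (v : 'I_n -> K) :
  f \is e.-homog -> f.@[fun i => c * v i] = c ^+ e * f.@[v].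
Proof.
move=> /dhomogP hf; rewrite !mevalE mulr_sumr; apply: eq_big_seq => m /hf me.
rewrite mulrCA; congr (_ * _); rewrite -me /= mdegE -prodrXr -big_split /=.
by apply: eq_bigr => i _; rewrite exprMn.
Qed.

Lemma poly_all_roots (K : numFieldType) (p : {poly K}) : (forall c, p.[c] = 0) -> p = 0.
Proof.
move=> h; apply/eqP; apply: contraT => p0.
have := @max_poly_roots _ p [seq i%:R | i <- iota 0 (size p)] p0.
rewrite size_map size_iota ltnn; apply.
  by apply/allP => c _; rewrite /root h.
rewrite map_inj_uniq ?iota_uniq // => i j /eqP.
by rewrite eqr_nat => /eqP.
Qed.

(** [H] need not be homogeneous. On a line through the origin it is a polynomial in the scaling
    factor, so if it vanishes on the whole line each homogeneous component does; the components cut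
    out closed sets. *)
Lemma zariski_closure_vanishing (K : numFieldType) n (S : set (proj_space K n))
    (H : {mpoly K[n.+1]}) :
  (forall q, S q -> vanishes_at H q) ->
  forall q, zariski_closure S q -> vanishes_at H q.
Proof.
move=> HS; pose N := mmeasure mdeg H; pose Hc e := pihomog mdeg e H.
have HE : H = \sum_(e < N) Hc e by apply: pihomog_partitionE.
have hHc e : Hc e \is e.-homog by apply: pihomogP.
have HcS q e : S q -> (e < N)%N -> vanishes_at (Hc e) q.
  move=> Sq eN v vq; pose P := \poly_(e < N) (Hc e).@[fun i => v ord0 i].
  have P0 : P = 0.
    apply: poly_all_roots => c; have := HS q Sq (c *: v) (memvZ c vq).
    rewrite HE raddf_sum /= /P horner_poly => hsum; rewrite -[RHS]hsum.
    apply: eq_bigr => j _; rewrite mulrC -(dhomog_meval _ _ (hHc j)).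
    by apply: meval_eq => i; rewrite mxE.
  by have := congr1 (fun Q : {poly K} => Q`_e) P0; rewrite coef0 coef_poly eN.
move=> q clq v vq; rewrite HE raddf_sum /= big1 // => e _.
suff : [set q | forall f, [set Hc e] f -> vanishes_at f q] q by move=> /(_ (Hc e) erefl); apply.
apply: clq; split=> [|q' Sq' f ->]; last exact: HcS.
by exists [set Hc e]; split=> // f ->; exists (e : nat).
Qed.

(** The spanning points lie only in the closure of the set of moment points. They are replaced one
    at a time: with the other summands fixed, [G] is a polynomial in the remaining one and vanishes
    on the closure if it does on moment points. *)
Lemma secant_variety_vanishing (K : numFieldType) D k d (G : {mpoly K[d.+1]}) :
  (exists e, G \is e.-homog) ->
  (forall p : 'I_(nvars k) -> K, G.@[fun r => (mixture_mpoly K D k r).@[p]] = 0) ->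
  forall q, secant_variety k (moment_variety K D d) q -> vanishes_at G q.
Proof.
move=> hG G0; apply: zariski_closure_vanishing => q [P [MP qP]] v vq.
pose S := [set q : proj_space K d | exists2 t : K * K, moments_defined D t &
  has_coords q (\row_(r < d.+1) moment D t r)].
have /memv_sumP[w wP ->] : v \in (\sum_(i < k) val (P i))%VS by apply: subvP vq.
have {}wP i : w i \in val (P i) by apply: wP.
(* Induction on [j]: the first [j] points may be in the closure, the others are moment points. *)
suff key j (p : 'I_k -> proj_space K d) (u : 'I_k -> 'rV[K]_d.+1) :
    (forall i : 'I_k, (i < j)%N -> moment_variety K D d (p i)) ->
    (forall i : 'I_k, (j <= i)%N -> S (p i)) -> (forall i, u i \in val (p i)) ->
    G.@[fun i => (\sum_i u i) ord0 i] = 0.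
  apply: (key k P w) => // i; first by rewrite leqNgt ltn_ord.
elim: j p u => [|j IH] p u h1 h2 hu.
  have /choice[t ht] i : exists t, moments_defined D t /\
      has_coords (p i) (\row_(r < d.+1) moment D t r).
    by have [t] := h2 i (leq0n _); exists t.
  have /choice[c hc] i : exists c, u i = c *: (\row_(r < d.+1) moment D (t i) r).
    by have := hu i; have [_ ->] := ht i; move/vlineP.
  rewrite -[RHS](G0 (param_of (fun i => moment_coords D (t i)) c)).
  apply: meval_eq => r; rewrite mixture_mpolyE summxE; apply: eq_bigr => i _.
  by rewrite hc !mxE param_weightK param_pointK -moment_mpolyP //; case: (ht i).
have [kj|jk] := leqP k j.
  apply: (IH p u) => // i; first by move=> ij; apply: h1; apply: leq_trans ij _.
  by move=> ji; have := leq_trans kj ji; rewrite leqNgt ltn_ord.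
pose jo := Ordinal jk.
pose rest := \sum_(i | i != jo) u i.
pose H := G \mPo [tuple 'X_i + (rest ord0 i)%:MP | i < d.+1].
have HE (z : 'rV_d.+1) : H.@[fun i => z ord0 i] = G.@[fun i => (z + rest) ord0 i].
  rewrite comp_mpoly_meval; apply: meval_eq => i.
  by rewrite tnth_mktuple mevalD mevalXU mevalC mxE.
rewrite (bigD1 jo) //= -/rest -HE.
apply: (@zariski_closure_vanishing K d S H _ (p jo) (h1 jo (ltnSn j)) _ (hu jo)).
move=> q' Sq' z zq'; rewrite HE.
pose p' i := if i == jo then q' else p i; pose u' i := if i == jo then z else u i.
have -> : z + rest = \sum_i u' i.
  rewrite (bigD1 jo) //= /u' eqxx; congr (_ + _).
  by apply: eq_bigr => i /negPf ->.
apply: (IH p' u') => i; rewrite /p' /u'.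
- move=> ij; have := ltn_eqF ij; rewrite -[j]/(val jo) val_eqE => ->.
  by apply: h1; apply: ltnW.
- move=> ji; case: eqP => // /eqP ne; apply: h2; rewrite ltn_neqAle ji andbT.
  by rewrite eq_sym -[j]/(val jo) val_eqE.
- by case: eqP.
Qed.

(** * The main theorem *)

Section Homogenization.
Variables (K : fieldType) (n : nat).
Implicit Types g : {mpoly K[n.+1]}.

(** Homogenization by ['X_ord0] in degree [mmeasure mdeg g], which for nonzero [g] is one more than
    the degree of [g]. *)
Definition homogenize g : {mpoly K[n.+1]} :=
  \sum_(e < mmeasure mdeg g) pihomog mdeg e g * 'X_ord0 ^+ (mmeasure mdeg g - e).

Lemma homogenize_homog g : homogenize g \is (mmeasure mdeg g).-homog.
Proof.
apply: rpred_sum => e _; set N := mmeasure mdeg g.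
suff : pihomog mdeg e g * 'X_ord0 ^+ (N - e) \is (e + 1 * (N - e))%N.-homog.
  by rewrite mul1n (subnKC (ltnW (ltn_ord e))).
apply: dhomogM; first exact: pihomogP.
by apply: dhomogMn; rewrite dhomogX /= mdeg1.
Qed.

Lemma homogenizeE g (w : 'I_n.+1 -> K) : w ord0 = 1 -> (homogenize g).@[w] = g.@[w].
Proof.
move=> w0; rewrite [in RHS](pihomog_partitionE (leqnn (mmeasure mdeg g))) /homogenize !raddf_sum /=.
by apply: eq_bigr => e _; rewrite mevalM rmorphXn /= mevalXU w0 expr1n mulr1.
Qed.

End Homogenization.

Definition coords_inv (K : fieldType) (D : distribution) (x : K * K) : K * K :=
  match D with
  | InverseGaussian => (x.1, x.1 ^+ 2 / x.2)
  | Gamma => (x.1 / x.2, x.2)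
  end.

Lemma moments_defined_inv (K : fieldType) D (x : K * K) :
  x.1 != 0 -> x.2 != 0 -> moments_defined D (coords_inv D x).
Proof. by case: D => //= h1 h2; apply/eqP; rewrite mulf_neq0 ?expf_neq0 ?invr_neq0. Qed.

Lemma coords_invK (K : fieldType) D (x : K * K) :
  x.1 != 0 -> x.2 != 0 -> moment_coords D (coords_inv D x) = x.
Proof.
case: x => m n; case: D => /= h1 h2; congr (_, _); last by rewrite divfK.
by field; rewrite h1 h2.
Qed.

Lemma moment_coordsK (K : fieldType) D (t x : K * K) :
  moments_defined D t -> x.1 != 0 -> x.2 != 0 -> moment_coords D t = x ->
  t = coords_inv D x.
Proof.
case: t => a b; case: D => /= d h1 h2 e; rewrite -e /= in h1 h2 *.
  by congr (_, _); move/eqP: d => d; field; rewrite ?h1 ?d.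
by rewrite mulfK.
Qed.

Definition relabel k (s : 'S_k) (v : 'I_(nvars k)) : 'I_(nvars k) :=
  let: (i, c) := enum_val v in var (s i) c.

Lemma relabel_var k (s : 'S_k) i c : relabel s (var i c) = var (s i) c.
Proof. by rewrite /relabel /var enum_rankK. Qed.

Definition nondegenerate (K : fieldType) k : {mpoly K[nvars k]} :=
  \prod_i ('X_(var i 0) * 'X_(var i 1)).

Lemma nondegenerateP (K : fieldType) k (p : 'I_(nvars k) -> K) :
  (nondegenerate K k).@[p] <> 0 <->
  forall i, (param_point p i).1 != 0 /\ (param_point p i).2 != 0.
Proof.
rewrite /nondegenerate (big_morph _ (mevalM p) (meval1 p)).
split=> [/eqP/prodf_neq0 h i|h].
  by have := h i isT; rewrite mevalM !mevalXU mulf_eq0 negb_or => /andP[].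
by apply/eqP/prodf_neq0 => i _; have [h1 h2] := h i; rewrite mevalM !mevalXU mulf_neq0.
Qed.

Lemma param_ext (K : fieldType) k (p p' : 'I_(nvars k) -> K) (s : 'S_k) :
  (forall i, param_point p i = param_point p' (s i)) ->
  (forall i, param_weight p i = param_weight p' (s i)) ->
  forall v, p v = p' (relabel s v).
Proof.
move=> hx ha v; rewrite -[v]enum_valK; case: (enum_val v) => i c.
rewrite -/(var i c) relabel_var; have [e0 e1] := hx i; have := ha i.
case: c => [[|[|[|//]]] hc] e2.
- by have -> : Ordinal hc = 0 by apply/val_inj.
- by have -> : Ordinal hc = 1 by apply/val_inj.
- by have -> : Ordinal hc = 2%:R by apply/val_inj.
Qed.

(** * From the cone map to generic points of the secant variety *)

Section Assembly.
Variables (K : numClosedFieldType) (D : distribution) (k : nat).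
Local Notation d := (3 * k + 2)%N.
Local Notation X := (secant_variety k (moment_variety K D d)).

Definition Phi (r : 'I_d.+1) : {mpoly K[nvars k]} := mixture_mpoly K D k r.

Lemma Phi0 p : (Phi ord0).@[p] = \sum_i param_weight p i.
Proof.
by rewrite mixture_mpolyE; apply: eq_bigr => i _; rewrite moment_mpoly0 meval1 mulr1.
Qed.

(* Over a point where [unique_fiber] holds, the fibre of the cone map in the
   coordinates (mu, nu) is the fibre of the mixture moment map. *)
Lemma unique_fiber_mixture (w : 'rV[K]_d.+1) (q : proj_space K d) :
  w ord0 ord0 = 1 -> val q = <[w]>%VS ->
  unique_fiber Phi (nondegenerate K k) (@relabel k) (fun r => w ord0 r) ->
  exists p : mixture_param K k, mixture_fiber D q = mixture_orbit p.
Proof.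
move=> w0 qw [u [/nondegenerateP nd wE uniq]].
pose x := param_point u; pose a := param_weight u.
have suma : \sum_i a i = 1 by rewrite -Phi0 -wE w0.
exists ([ffun i => coords_inv D (x i)], [ffun i => a i]); apply/seteqP; split.
- move=> [t b] [/= [td sb] qc].
  have mw : mixture_moments D d (t, b) = w.
    have : mixture_moments D d (t, b) \in <[w]>%VS.
      by rewrite -qw qc memv_line.
    (* Both vectors span the same line, and both have zeroth coordinate [1]. *)
    move=> /vlineP[c ec]; suff c1 : c = 1 by rewrite ec c1 scale1r.
    have := congr1 (fun z : 'rV_d.+1 => z ord0 ord0) ec; rewrite !mxE w0 mulr1 => <-.
    rewrite -sb; apply: eq_bigr => i _.
    by rewrite moment_mpolyP // moment_mpoly0 meval1 mulr1.
  pose u' := param_of (fun i => moment_coords D (t i)) b.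
  have [r|s hs] := uniq u'.
    rewrite -mw mxE mixture_mpolyE; apply: eq_bigr => i _ /=.
    by rewrite param_weightK param_pointK -moment_mpolyP.
  exists s => //; rewrite /permute_mixture /=; congr (_, _); apply/ffunP => i; rewrite !ffunE.
    apply/esym/moment_coordsK => //; [by case: (nd (s i)) | by case: (nd (s i)) |].
    have <- : param_point u' i = x (s i) by rewrite /param_point !hs !relabel_var.
    by rewrite param_pointK.
  have := hs (var i 2%:R); rewrite relabel_var => e.
  by rewrite /a /param_weight -e -[LHS]/(param_weight u' i) param_weightK.
move=> _ [s _ <-]; split=> /=.
  split=> [i|]; first by rewrite !ffunE; apply: moments_defined_inv; case: (nd (s i)).
  rewrite -[RHS]suma [RHS](reindex_inj (@perm_inj _ s)).
  by apply: eq_bigr => i _; rewrite !ffunE.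
rewrite /has_coords qw; congr (<[_]>%VS); apply/rowP => r.
rewrite mxE -[RHS]/(\sum_(i < k) _) wE mixture_mpolyE (reindex_inj (@perm_inj _ s)) /=.
apply: eq_bigr => i _; rewrite !ffunE; have [h1 h2] := nd (s i).
by rewrite moment_mpolyP ?coords_invK //; apply: moments_defined_inv.
Qed.

Lemma mixture_in_secant (q : proj_space K d) (p : 'I_(nvars k) -> K) :
  (forall i, (param_point p i).1 != 0) -> (forall i, (param_point p i).2 != 0) ->
  val q = <[\row_r (Phi r).@[p]]>%VS -> X q.
Proof.
move=> h1 h2 qE Z [_ sZ]; apply: sZ.
pose v i : 'rV[K]_d.+1 := \row_r moment D (coords_inv D (param_point p i)) r.
have v0 i : v i != 0.
  apply/negP => /eqP/rowP/(_ ord0)/eqP; rewrite !mxE.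
  rewrite moment_mpolyP; last exact: moments_defined_inv.
  by rewrite moment_mpoly0 meval1 oner_eq0.
have dv i : \dim <[v i]>%VS == 1%N by rewrite dim_vline v0.
exists (fun i => exist _ <[v i]>%VS (dv i)); split=> [i|].
  move=> Z' [_ sZ']; apply: sZ'.
  by exists (coords_inv D (param_point p i)); [apply: moments_defined_inv|].
rewrite qE; apply/subvP => _ /vlineP[c ->]; apply: memvZ.
have -> : \row_r (Phi r).@[p] = \sum_i param_weight p i *: v i.
  apply/rowP => r; rewrite mxE mixture_mpolyE summxE; apply: eq_bigr => i _.
  rewrite !mxE moment_mpolyP; last exact: moments_defined_inv.
  by rewrite coords_invK.
apply: memv_suml => i _; apply: memvZ; apply: (subvP (sumv_sup i _ (subvv _))) => //=.
exact: memv_line.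
Qed.

(** Each polynomial in [gs] has a homogenization that vanishes either on the whole image of the cone
    map, hence on the secant variety, or not at the generic point [p]. The product of those of the
    second kind defines the open set, on which [unique_fiber] is transferred from the generic
    point. *)
Lemma generic_unique_fiber (uncK : forall f : nat -> K, exists a, forall n, f n <> a) :
  (0 < k)%N ->
  for_generic X [set q | exists p : mixture_param K k, mixture_fiber D q = mixture_orbit p].
Proof.
move=> kpos.
have [gs hgs] := unique_fiber_atoms Phi (nondegenerate K k) (@relabel k).
pose Hg g := homogenize g \mPo [tuple Phi r | r < d.+1].
have HgE g p : (Hg g).@[p] = (homogenize g).@[fun r => (Phi r).@[p]].
  by rewrite /Hg comp_mpoly_meval; apply: meval_eq => r; rewrite tnth_mktuple.
(* The factor ['X_ord0] ensures that coordinates can be normalised to have zeroth entry [1]. *)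
pose G : {mpoly K[d.+1]} := 'X_ord0 * \prod_(g <- gs | Hg g != 0) homogenize g.
have hG : exists e, G \is e.-homog.
  suff [e he] : exists e, \prod_(g <- gs | Hg g != 0) homogenize g \is e.-homog.
    by exists (1 + e)%N; apply: dhomogM => //; rewrite dhomogX /= mdeg1.
  elim: (gs) => [|g s [e he]]; first by exists 0%N; rewrite big_nil dhomog1.
  rewrite big_cons; case: ifP => _; last by exists e.
  by exists (mmeasure mdeg g + e)%N; apply: dhomogM => //; apply: homogenize_homog.
have O0 : \prod_(g <- gs | Hg g != 0) Hg g != 0.
  by rewrite prodf_seq_neq0; apply/allP => g _; apply/implyP.
have [p [Op p1 p2 sp uniq]] := generic_parameter D uncK kpos O0.
set s := \sum_i _ in sp.
(* The cone map is linear in the weights, so dividing them by their sum puts the image in the chart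
   where the zeroth coordinate is [1]. *)
pose p' := param_of (param_point p) (fun i => s^-1 * param_weight p i).
have PhiE r : (Phi r).@[p'] = s^-1 * (Phi r).@[p].
  rewrite !mixture_mpolyE mulr_sumr; apply: eq_bigr => i _.
  by rewrite param_weightK param_pointK mulrA.
pose w : 'rV[K]_d.+1 := \row_r (Phi r).@[p'].
have wE r : w ord0 r = s^-1 * (Phi r).@[p] by rewrite mxE PhiE.
have w0 : w ord0 ord0 = 1 by rewrite wE Phi0 mulVf.
have Hgw g : (homogenize g).@[fun r => w ord0 r] = s^-1 ^+ (mmeasure mdeg g) * (Hg g).@[p].
  rewrite HgE -(dhomog_meval _ _ (homogenize_homog g)).
  by apply: meval_eq => r; rewrite wE.
have Hgp g : g \in gs -> Hg g != 0 -> (homogenize g).@[fun r => w ord0 r] != 0.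
  move=> gg g0; rewrite Hgw mulf_neq0 ?expf_neq0 ?invr_neq0 //.
  move: Op; rewrite (big_morph _ (mevalM p) (meval1 p)) prodf_seq_neq0.
  by move=> /allP/(_ g gg)/implyP; apply.
have uw : unique_fiber Phi (nondegenerate K k) (@relabel k) (fun r => w ord0 r).
  exists p'; split=> [|r|u hu].
  - by apply/nondegenerateP => i; rewrite param_pointK.
  - by rewrite mxE.
  have [r rd|t ht] := uniq (param_point u) (fun i => s * param_weight u i).
    have rd' : (r < d.+1)%N by rewrite addnS in rd.
    have := hu (Ordinal rd'); rewrite wE => /(congr1 ( *%R s)).
    rewrite mulVKf // !mixture_mpolyE => ->; rewrite mulr_sumr.
    by apply: eq_bigr => i _; rewrite mulrA.
  exists t; apply: param_ext => i; first by rewrite param_pointK; case: (ht i).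
  by rewrite param_weightK; case: (ht i) => _ <-; rewrite mulKf.
have w_neq0 : w != 0.
  by apply/negP => /eqP/rowP/(_ ord0)/eqP; rewrite w0 mxE oner_eq0.
have dw : \dim <[w]>%VS == 1%N by rewrite dim_vline w_neq0.
pose q0 : proj_space K d := exist _ <[w]>%VS dw.
exists [set q | vanishes_at G q]; split.
- exists [set G]; split=> [f -> //|].
  by apply/seteqP; split=> q h; [move=> f ->|apply: h].
- exists q0; split.
    by apply: (@mixture_in_secant q0 p') => // i; rewrite param_pointK.
  move=> /(_ w (memv_line w))/eqP; rewrite mevalM mevalXU w0 mul1r.
  apply/negP; rewrite (big_morph _ (mevalM _) (meval1 _)) prodf_seq_neq0.
  by apply/allP => g gg; apply/implyP; apply: Hgp.
move=> q [Xq nGq].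
have [v vq Gv] : exists2 v, v \in val q & G.@[fun i => v ord0 i] <> 0.
  apply: contrapT => nv; apply: nGq => v vq; apply: contrapT => Gv; apply: nv.
  by exists v.
have [e he] := hG.
have v0 : v ord0 ord0 != 0.
  by apply/eqP => v0; apply: Gv; rewrite mevalM mevalXU v0 mul0r.
pose z := (v ord0 ord0)^-1 *: v.
have z0 : z ord0 ord0 = 1 by rewrite mxE mulVf.
have zq : z \in val q by apply: memvZ.
have qz : val q = <[z]>%VS.
  apply/esym/eqP; rewrite eqEdim -memvE zq (eqP (svalP q)) dim_vline.
  by case: eqP => // z_0; move: z0; rewrite z_0 mxE => /esym/eqP; rewrite oner_eq0.
have Gz : G.@[fun i => z ord0 i] != 0.
  have -> : G.@[fun i => z ord0 i] = (v ord0 ord0)^-1 ^+ e * G.@[fun i => v ord0 i].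
    by rewrite -(dhomog_meval _ _ he); apply: meval_eq => i; rewrite mxE.
  by rewrite mulf_neq0 ?expf_neq0 ?invr_neq0 //; apply/eqP.
apply: (unique_fiber_mixture z0 qz).
(* It remains to see that [g] vanishes at [z] exactly when it vanishes at [w]: it does at both or at
   neither, according to whether [Hg g] is zero. *)
apply: (hgs _ _ _ uw) => g gg.
rewrite -(homogenizeE g w0) -(homogenizeE g z0).
have [g0|g0] := eqVneq (Hg g) 0.
  rewrite Hgw g0 meval0 mulr0 eqxx; apply/esym/eqP.
  apply: (secant_variety_vanishing _ _ Xq zq); first by exists (mmeasure mdeg g); apply: homogenize_homog.
  by move=> u; rewrite -HgE g0 meval0.
rewrite (negPf (Hgp g gg g0)); apply/esym/negbTE.
move: Gz; rewrite mevalM mulf_eq0 negb_or => /andP[_].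
rewrite (big_morph _ (mevalM _) (meval1 _)) prodf_seq_neq0.
by move=> /allP/(_ g gg)/implyP; apply.
Qed.

End Assembly.

Theorem theorem1p2 (R : realType) (D : distribution) (k : nat) (hk : (2 <= k)%N) :
  for_generic (secant_variety k (moment_variety R[i] D (3 * k + 2)%N))
    [set q | exists p : mixture_param R[i] k,
       mixture_fiber D q = mixture_orbit p].
Proof.
by apply: generic_unique_fiber; [exact: complex_uncountable|exact: ltnW].
Qed.
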